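(* For the online non-preemptive problem of minimizing total weighted flow-time on unrelated machines in the rejection model, there exist absolute constants $c_1, c_2 > 0$ such that for every $0 < \epsilon < 1$ there is an online algorithm that is $\frac{c_1}{\epsilon^3}$-competitive and rejects jobs of total weight at most $c_2\,\epsilon \sum_{j \in \mathcal{J}} w_j$. That is, on every instance, the algorithm rejects jobs of total weight at most $c_2 \epsilon \sum_{j} w_j$, and the total weighted flow-time $\sum_{j \text{ not rejected}} w_j (C_j - r_j)$ of the remaining jobs in its schedule is at most $\frac{c_1}{\epsilon^3}$ times the minimum total weighted flow-time $\sum_{j \in \mathcal{J}} w_j (C^*_j - r_j)$ of an offline optimal schedule that must complete all jobs.
   Context: There is a set $\mathcal{M}$ of unrelated machines and a set $\mathcal{J}$ of jobs arriving online. Each job $j$ has a release time $r_j$, a weight $w_j > 0$, and a processing time $p_{ij}$ if executed on machine $i$; the algorithm learns job $j$ (and all its parameters) only at time $r_j$. Each machine processes at most one job at a time. A schedule is non-preemptive: once a job is started on a machine it must run there without interruption until completion (the algorithm may, however, abort a started job, in which case that job counts as rejected and is never executed again). In the rejection model, the online algorithm may reject jobs (at any time, irrevocably); rejected jobs are not required to be completed and do not contribute to the algorithm's objective, while the adversary (offline optimum, which knows the whole instance in advance) must complete all jobs. The completion time of job $j$ is $C_j$ and its flow-time is $C_j - r_j$; the objective is the total weighted flow-time. An online algorithm is $c$-competitive if on every instance its objective is at most $c$ times that of the optimal offline schedule. The constants $c_1, c_2$ do not depend on $\epsilon$ or on the instance. *)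

(* Defs.v *)
From mathcomp Require Import all_boot all_order all_algebra finmap.
From mathcomp Require Import classical_sets reals.

Set Implicit Arguments.
Unset Strict Implicit.
Unset Printing Implicit Defensive.

Import Order.TTheory GRing.Theory Num.Theory.
Local Open Scope ring_scope.
Local Open Scope classical_set_scope.

(* Jobs carry arbitrary natural-number names; the values of [release], [weight]
   and [proc] outside [jobs] are meaningless and unconstrained. *)
Record instance (R : realType) (m : nat) := Instance {
  jobs : {fset nat};
  release : nat -> R;
  weight : nat -> R;
  proc : 'I_m -> nat -> R;
  weight_gt0 : forall j, j \in jobs -> 0 < weight j;
  proc_gt0 : forall i j, j \in jobs -> 0 < proc i j
}.

(* [start S j = Some (i, s)]: job j is started on machine i at time s (at most
   once, hence without preemption, migration or restart).
   [reject S j = Some x]: job j is rejected at time x; if it has been started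
   before, it is aborted at time x. *)
Record schedule (R : realType) (m : nat) := Schedule {
  start : nat -> option ('I_m * R);
  reject : nat -> option R
}.

Section Scheduling.
Context {R : realType} {m : nat}.
Implicit Types (I : instance R m) (S : schedule R m).

Definition rejected S (j : nat) : bool := isSome (reject S j).

(* The value 0 is never relevant: in a feasible schedule every job that is not
   rejected is started. *)
Definition completion I S (j : nat) : R :=
  if start S j is Some (i, s) then s + proc I i j else 0.

Definition processing I S (i : 'I_m) (j : nat) (t : R) : bool :=
  if start S j is Some (k, s) then
    [&& k == i, s <= t &
        t < (if reject S j is Some x then x else s + proc I k j)]
  else false.

(* A job may be rejected before being started, or while it is running, but
   neither before its release nor once it is completed. *)
Definition valid_job I S (j : nat) : bool :=
  match start S j, reject S j with
  | Some (i, s), None => release I j <= s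
  | Some (i, s), Some x => [&& release I j <= s, s <= x & x < s + proc I i j]
  | None, Some x => release I j <= x
  | None, None => false
  end.

Definition feasible I S : Prop :=
  (forall j, j \in jobs I -> valid_job I S j) /\
  (forall i t j k, j \in jobs I -> k \in jobs I ->
     processing I S i j t -> processing I S i k t -> j = k).

Definition complete I S : Prop :=
  feasible I S /\ (forall j, j \in jobs I -> ~~ rejected S j).

Definition weighted_flow_time I S : R :=
  \sum_(j <- jobs I | ~~ rejected S j)
     weight I j * (completion I S j - release I j).

Definition rejected_weight I S : R :=
  \sum_(j <- jobs I | rejected S j) weight I j.

Definition total_weight I : R := \sum_(j <- jobs I) weight I j.

(* For m > 0 the set is nonempty and bounded below by 0, so that [inf] does not
   take its default value; the infimum is attained. *)
Definition opt I : R := inf [set weighted_flow_time I S | S in complete I].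

Definition released I (t : R) (j : nat) : bool :=
  (j \in jobs I) && (release I j <= t).

Definition agree_upto (t : R) I1 I2 : Prop :=
  forall j, released I1 t j = released I2 t j /\
    (released I1 t j ->
       [/\ release I1 j = release I2 j, weight I1 j = weight I2 j
         & forall i, proc I1 i j = proc I2 i j]).

Definition start_upto S (t : R) (j : nat) : option ('I_m * R) :=
  if start S j is Some (i, s) then
    if s <= t then Some (i, s) else None
  else None.

Definition reject_upto S (t : R) (j : nat) : option R :=
  if reject S j is Some x then if x <= t then Some x else None else None.

Definition nonanticipative (A : instance R m -> schedule R m) : Prop :=
  forall t I1 I2, agree_upto t I1 I2 ->
  forall j, released I1 t j ->
    start_upto (A I1) t j = start_upto (A I2) t j /\
    reject_upto (A I1) t j = reject_upto (A I2) t j.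

End Scheduling.

Record online_algorithm (R : realType) (m : nat) := OnlineAlgorithm {
  run :> instance R m -> schedule R m;
  run_feasible : forall I, feasible I (run I);
  run_nonanticipative : nonanticipative run
}.

Definition competitive (R : realType) (m : nat) (c : R)
    (A : online_algorithm R m) : Prop :=
  forall I : instance R m, weighted_flow_time I (A I) <= c * opt I.

(* Main.v *)
(** Every arriving job [j] is dispatched to a machine minimising
    [lambda_ij + (16/eps) w_j p_ij], where [lambda_ij] is the increase it causes
    in the weighted waiting time of the pending queue of [i], served densest job
    first.  A running job is aborted once the weight arriving during its
    execution exceeds [1/eps] times its own.  A job is rejected on arrival only
    if its delay [lambda_j / w_j] is long compared with [p_j]; long jobs are
    grouped by the power of 4 below their delay, and in each group about an [eps]
    fraction of the weight is rejected.

    Let the clock of a machine count aborted jobs at their full size.  Measured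
    on it, the waiting cost of the queue is the sum of [lambda] over the accepted
    jobs, so the rejected [lambda] is a gain.  This gain is at least about
    [eps/8] times the total [lambda], up to a multiple of [sum w_j p_j]: what the
    groups fail to reject is carried by one job per group, which guarantees a
    heavy queue on a window of clock time of length proportional to the delay of
    the group, and windows of geometrically growing lengths are almost disjoint.

    On the dual side, compare [j] with the interval in which the adversary runs
    it.  The jobs pending at the arrival of [j] and due (on the clock) before the
    end of that interval fit into the flow time of [j]; each of the others is
    pending during the whole interval, and the disjoint intervals of the
    adversary charge it at most its own delay. *)

Require Import Defs.
From mathcomp Require Import all_boot all_order all_algebra finmap.
From mathcomp Require Import classical_sets reals.
From mathcomp Require Import ring lra zify.

Import Order.TTheory GRing.Theory Num.Theory.
Local Open Scope ring_scope.

Set Implicit Arguments.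
Unset Strict Implicit.
Unset Printing Implicit Defensive.

(* [avail]: end of the current execution; [log]: started jobs in starting order;
   [cnt]: weight accepted during the current execution; [cred a]: rejection
   credit of the jobs whose delay has rounding [a]. *)
Record mstate (R : Type) (T : Type) := MState {
  avail : R;
  pend : seq T;
  log : seq T;
  cnt : R;
  cred : R -> R;
  stime : T -> option R;
  rtime : T -> option R
}.

(** * A single machine *)

Section Machine.
Variables (R : realFieldType) (T : eqType) (key : R -> R) (eps kap : R).
Variables (w p r : T -> R).
Implicit Types (m : mstate R T) (x y u k : T) (s : seq T) (c : pred R).

(* Never overwriting makes it evident that later decisions leave the past
   unchanged. *)
Definition set_once (f : T -> option R) x v : T -> option R :=
  fun y => if f y is Some v' then Some v' else if y == x then Some v else None.

Fixpoint densest x s : T :=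
  if s is k :: s' then
    let b := densest k s' in if w b * p x <= w x * p b then x else b
  else x.

Definition start_next m : mstate R T :=
  if pend m is x :: s then
    let u := densest x s in
    MState (avail m + p u) (rem u (pend m)) (rcons (log m) u) 0 (cred m)
      (set_once (stime m) u (avail m)) (rtime m)
  else m.

(** The guard [c] tells at which times a start is still allowed. Each start removes one pending job,
    so [size (pend m)] is enough fuel. *)
Fixpoint advance_rec n c m : mstate R T :=
  if n is n'.+1 then
    if (pend m != [::]) && c (avail m) then advance_rec n' c (start_next m) else m
  else m.

Definition advance c m := advance_rec (size (pend m)) c m.

(** This is the [lambda] of [x]: of [x] and [k] the less dense one waits for the other, and the
    minimum is the weighted waiting that results. *)
Definition delay_cost m x : R :=
  \sum_(k <- pend m) Num.min (w x * p k) (w k * p x).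

Definition is_long m x : bool := kap * (w x * p x) < delay_cost m x.
Definition level m x : R := key (delay_cost m x / w x).
(** A long job is rejected exactly when the credit of its level, including the [eps * w x] that it
    brings itself, pays for its whole weight. *)
Definition accepts m x : bool :=
  ~~ (is_long m x && (w x <= cred m (level m x) + eps * w x)).

Definition credit m x : R -> R :=
  if is_long m x then
    fun a => if a == level m x then
               cred m a + (eps * w x - (if accepts m x then 0 else w x))
             else cred m a
  else cred m.

(* The last started job [u] is the one running when [r x < avail m]. *)
Definition arrive m x : mstate R T :=
  let u := last x (log m) in
  if ~~ accepts m x then
    MState (avail m) (pend m) (log m) (cnt m) (credit m x) (stime m)
      (set_once (rtime m) x (r x))
  else if avail m <= r x then
    MState (r x) (x :: pend m) (log m) (cnt m) (credit m x) (stime m) (rtime m)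
  else if w u <= eps * (cnt m + w x) then
    MState (r x) (x :: pend m) (log m) 0 (credit m x) (stime m)
      (set_once (rtime m) u (r x))
  else
    MState (avail m) (x :: pend m) (log m) (cnt m + w x) (credit m x)
      (stime m) (rtime m).

Definition step (a : pred T) m x : mstate R T :=
  let m' := advance (fun t => t < r x) m in
  if a x then arrive m' x else m'.

Definition finish m := advance xpredT m.

Lemma densest_mem x s : densest x s \in x :: s.
Proof.
elim: s x => [|k s IH] x /=; first by rewrite mem_seq1.
by case: ifP => _; rewrite inE ?eqxx // IH orbT.
Qed.

Lemma densestP x s : {in x :: s, forall k, 0 < p k} ->
  {in x :: s, forall k, w k * p (densest x s) <= w (densest x s) * p k}.
Proof.
elim: s x => [|k s IH] x hp y /=; first by rewrite mem_seq1 => /eqP ->.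
have hp' : {in k :: s, forall k, 0 < p k}.
  by move=> z hz; apply: hp; rewrite inE hz orbT.
have bin : densest k s \in x :: k :: s by rewrite inE densest_mem orbT.
have pb := hp _ bin; have px := hp _ (mem_head _ _).
rewrite inE => /predU1P[->|hy].
  by case: ifP => [//|/negbT]; rewrite -ltNge => /ltW.
have hb := IH _ hp' _ hy.
case: ifP => // hx; have py := hp' _ hy.
rewrite -(ler_pM2r pb) -mulrA [p x * _]mulrC mulrA.
apply: (le_trans (ler_wpM2r (ltW px) hb)).
by rewrite -mulrA [p y * _]mulrC mulrA -[leRHS]mulrA [p y * _]mulrC [leRHS]mulrA ler_pM2r.
Qed.

Lemma size_start_next m : size (pend (start_next m)) = (size (pend m)).-1.
Proof.
rewrite /start_next; case E: (pend m) => [|x s]; first by rewrite E.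
by rewrite -[pend _]/(rem (densest x s) (x :: s)) size_rem ?densest_mem.
Qed.

Lemma start_next_ex m : pend m != [::] ->
  exists u, [/\ u \in pend m,
    {in pend m, forall k, 0 < p k} -> {in pend m, forall k, w k * p u <= w u * p k} &
    start_next m = MState (avail m + p u) (rem u (pend m)) (rcons (log m) u) 0
      (cred m) (set_once (stime m) u (avail m)) (rtime m)].
Proof.
rewrite /start_next; case E: (pend m) => [|x s] //= _.
by exists (densest x s); split; [exact: densest_mem | exact: densestP |].
Qed.

Lemma advance_ind (P : mstate R T -> Prop) c m :
  (forall m', pend m' != [::] -> c (avail m') -> P m' -> P (start_next m')) ->
  P m -> P (advance c m).
Proof.
rewrite /advance; move: (size (pend m)) => n h; elim: n m => [|n IH] m //= Pm.
by case: ifP => // /andP[h1 h2]; apply/IH/h.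
Qed.

Lemma advance_exit c m :
  pend (advance c m) = [::] \/ ~~ c (avail (advance c m)).
Proof.
rewrite /advance; move: {2}(size _) (leqnn (size (pend m))) => n.
elim: n m => [|n IH] m /= hm.
  by move: hm; case E: (pend m) => [|? ?] //= _; left.
case: (ltnP n (size (pend m))) => hn; last first.
  by apply: IH.
have -> : size (pend m) = n.+1 by apply/eqP; rewrite eqn_leq hm hn.
rewrite /=; case: ifP => [/andP[h1 h2]|/negbT].
  have := IH (start_next m); rewrite size_start_next.
  have -> : size (pend m) = n.+1 by apply/eqP; rewrite eqn_leq hm hn.
  by rewrite /=; apply.
by rewrite negb_and negbK => /orP[/eqP|]; [left|right].
Qed.

Lemma advanceE c m : advance c m =
  if (pend m != [::]) && c (avail m) then advance c (start_next m) else m.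
Proof.
rewrite /advance size_start_next; case E: (pend m) => [|x s] /=.
  by [].
by rewrite E /=.
Qed.

Lemma advance_comp c1 c2 m : (forall t, c1 t -> c2 t) ->
  advance c2 (advance c1 m) = advance c2 m.
Proof.
move=> h; move: {2}(size _) (leqnn (size (pend m))) => n.
elim: n m => [|n IH] m hm.
  by rewrite (advanceE c1); case: (pend m) hm => [|? ?].
rewrite (advanceE c1); case: ifP => [/andP[h1 h2]|//].
rewrite IH ?size_start_next; last by case: (size _) hm.
by rewrite [RHS]advanceE h1 (h _ h2).
Qed.

End Machine.

(** * Invariants of the machine state *)

Section Invariant.
Variables (R : realFieldType) (T : eqType) (key : R -> R) (eps kap : R).
Variables (w p r : T -> R) (nprior : T -> nat) (resid clock : T -> R).
Implicit Types (m : mstate R T) (x y u k : T) (s A : seq T) (c : pred R).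

Definition load s : R := \sum_(u <- s) p u.
Definition begins m x : R := odflt 0 (stime m x).
Definition ends m x : R := odflt (begins m x + p x) (rtime m x).
(** Real time minus clock time when the machine becomes available after the arrival of [x]. While
    [x] waits the machine never idles, and an abort makes real time lag behind the clock, so adding
    this offset to a later clock value bounds real time from above. *)
Definition clock_offset x : R := r x + resid x - clock x.

(* [A]: jobs accepted so far; [Rj]: jobs rejected on arrival.  For an accepted
   job, [nprior] is the number of starts before its arrival, [clock] their total
   size, and [resid] the time from its arrival until the machine is available. *)
Record inv A (Rj : seq T) m : Prop := Inv {
  inv_perm : perm_eq (log m ++ pend m) A;
  inv_unstarted : forall x, x \notin log m -> stime m x = None;
  inv_started : forall x, x \in log m ->
    [/\ stime m x = Some (begins m x), r x <= begins m x,
        begins m x <= clock_offset x + load (take (index x (log m)) (log m)),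
        ends m x <= avail m &
        forall t, rtime m x = Some t -> begins m x <= t < begins m x + p x];
  inv_pend_rtime : forall x, x \in pend m -> rtime m x = None;
  inv_rtime : forall x, x \notin A ->
    rtime m x = if x \in Rj then Some (r x) else None;
  inv_disjoint : forall x y, x \in log m -> y \in log m ->
    (index x (log m) < index y (log m))%N -> ends m x <= begins m y;
  inv_release : forall x, x \in pend m -> r x <= avail m;
  inv_base : forall x, x \in pend m -> avail m <= clock_offset x + load (log m);
  inv_hdf : forall u k, u \in log m -> k \in A -> (nprior k <= index u (log m))%N ->
    (index u (log m) <= index k (log m))%N -> w k * p u <= w u * p k;
  inv_wait : eps * (\sum_(k <- A) w k * resid k) <= \sum_(u <- log m) w u * p u;
  inv_abort : \sum_(u <- log m | rtime m u) w u <= eps * \sum_(k <- A) w k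
}.

(** While [u] is running, [inv_wait] and [inv_abort] hold with slack. Of the [w u * p u] gained by
    starting [u], the part [eps * cnt * p u] is set aside for the waits of later arrivals; likewise
    [eps * cnt] of the abort budget is saved up for a possible abort of [u]. *)
Definition busy A t m : Prop := t < avail m -> exists s u,
  [/\ log m = rcons s u, rtime m u = None, begins m u + p u = avail m, begins m u < t &
   eps * (\sum_(k <- A) w k * resid k) + (w u - eps * cnt m) * p u
     <= \sum_(u <- log m) w u * p u /\
   \sum_(u <- log m | rtime m u) w u + eps * cnt m <= eps * \sum_(k <- A) w k].

Lemma index_rcons_in s u x : x \in s -> index x (rcons s u) = index x s.
Proof. by move=> h; rewrite -cats1 index_cat h. Qed.

Lemma index_rcons_last s u : u \notin s -> index u (rcons s u) = size s.
Proof. by move=> h; rewrite -cats1 index_cat (negbTE h) /= eqxx addn0. Qed.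

Lemma take_index_rcons s u x : x \in s ->
  take (index x (rcons s u)) (rcons s u) = take (index x s) s.
Proof.
move=> h; rewrite index_rcons_in // -cats1 takel_cat //.
by rewrite index_size.
Qed.

Lemma busy_le A t t' m : t <= t' -> busy A t m -> busy A t' m.
Proof.
move=> tt' h /(le_lt_trans tt') /h [s [u [h1 h2 h3 h4 h5]]].
by exists s, u; split=> //; apply: lt_le_trans h4 tt'.
Qed.

(** [inv_base] survives because [avail] and the clock both grow by [p u], and it bounds the starting
    time of the new job [u]. The density clause for [u] is the choice made by [densest]. *)
Lemma start_inv A Rj m : uniq A -> {in A, forall x, 0 < p x} ->
  {in A, forall x, 0 < w x} ->
  pend m != [::] -> inv A Rj m -> inv A Rj (start_next w p m).
Proof.
move=> uA pA wA pm I.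
have permA := inv_perm I.
have uLP : uniq (log m ++ pend m) by rewrite (perm_uniq permA).
have memA x : (x \in A) = (x \in log m) || (x \in pend m).
  by rewrite -(perm_mem permA) mem_cat.
have [uL dLP uP] : [/\ uniq (log m), {in pend m, forall x, x \notin log m} & uniq (pend m)].
  move: uLP; rewrite cat_uniq => /and3P[-> /hasPn h ->]; split=> // x /h.
have [u [up hu ->]] := start_next_ex w p pm.
have pP : {in pend m, forall k, 0 < p k} by move=> x hx; apply: pA; rewrite memA hx orbT.
move/(_ pP) in hu.
have uA' : u \in A by rewrite memA up orbT.
have uNL := dLP _ up.
have stu : stime m u = None by apply: (inv_unstarted I).
have rtu : rtime m u = None by apply: (inv_pend_rtime I).
have svL x : x \in log m -> set_once (stime m) u (avail m) x = stime m x.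
  by move=> /(inv_started I)[h _ _ _ _]; rewrite /set_once h.
have svu : set_once (stime m) u (avail m) u = Some (avail m).
  by rewrite /set_once stu eqxx.
split=> /=.
- rewrite -cats1 -catA; apply: perm_trans permA; rewrite perm_cat2l perm_sym.
  exact: perm_to_rem.
- move=> x; rewrite mem_rcons inE negb_or => /andP[/negbTE xu /(inv_unstarted I) h].
  by rewrite /set_once h xu.
- move=> x; rewrite mem_rcons inE => /predU1P[->|xL].
    rewrite /begins /ends /= svu rtu /=; split=> //.
    + exact: (inv_release I).
    + rewrite index_rcons_last // -cats1 take_size_cat //.
      exact: (inv_base I).
    + by rewrite /begins /= svu.
  have [h1 h2 h3 h4 h5] := inv_started I xL.
  rewrite /ends /begins /= svL // take_index_rcons //; split=> //.
  apply: le_trans h4 _; rewrite lerDl; apply/ltW/pP/up.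
- by move=> x /mem_rem; exact: (inv_pend_rtime I).
- exact: (inv_rtime I).
- move=> x y; rewrite !mem_rcons !inE => /predU1P[->|xL] /predU1P[->|yL].
  + by rewrite ltnn.
  + by rewrite index_rcons_last // index_rcons_in // ltnNge index_size.
  + move=> _; rewrite /ends /begins /= svu svL //=.
    by have [] := inv_started I xL.
  + rewrite !index_rcons_in // /ends /begins /= !svL //.
    exact: (inv_disjoint I).
- move=> x /mem_rem /(inv_release I) h; apply: le_trans h _.
  by rewrite lerDl; apply/ltW/pP/up.
- move=> x /mem_rem /(inv_base I); rewrite /load big_rcons /= => h; lra.
- move=> v k; rewrite mem_rcons inE => /predU1P[->|vL] kA.
    rewrite index_rcons_last // => _ hk; apply: hu.
    move: kA; rewrite memA => /orP[kL|//].
    by move: hk; rewrite index_rcons_in // leqNgt index_mem kL.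
  rewrite (index_rcons_in _ vL) => h1 h2; apply: (inv_hdf I) => //.
  move: kA; rewrite memA => /orP[kL|/dLP kL].
    by rewrite index_rcons_in // in h2.
  by rewrite (memNindex kL) index_size.
- rewrite big_rcons /=; have := inv_wait I.
  have := mulr_gt0 (wA _ uA') (pA _ uA'); lra.
- by rewrite -cats1 big_cat /= big_cons big_nil rtu /= addr0; exact: (inv_abort I).
Qed.

Lemma start_busy A Rj m t : uniq A -> {in A, forall x, 0 < p x} ->
  {in A, forall x, 0 < w x} -> avail m < t ->
  pend m != [::] -> inv A Rj m -> busy A t (start_next w p m).
Proof.
move=> uA pA wA ft pm I.
have [u [up _ ->]] := start_next_ex w p pm.
have permA := inv_perm I.
have uA' : u \in A by rewrite -(perm_mem permA) mem_cat up orbT.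
have uNL : u \notin log m.
  have : uniq (log m ++ pend m) by rewrite (perm_uniq permA).
  by rewrite cat_uniq => /and3P[_ /hasPn /(_ u up)].
have stu : stime m u = None by apply: (inv_unstarted I).
have rtu : rtime m u = None by apply: (inv_pend_rtime I).
move=> _; exists (log m), u.
have svu : set_once (stime m) u (avail m) u = Some (avail m).
  by rewrite /set_once stu eqxx.
rewrite /begins /= svu /= mulr0 subr0; split=> //; split.
  rewrite big_rcons /=; have := inv_wait I; lra.
rewrite -cats1 big_cat /= big_cons big_nil rtu /= !addr0.
exact: (inv_abort I).
Qed.

Lemma inv_uniq A Rj m : uniq A -> inv A Rj m ->
  [/\ uniq (log m), {in pend m, forall x, x \notin log m},
     {subset log m <= A} & {subset pend m <= A}].
Proof.
move=> uA I; have permA := inv_perm I.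
have : uniq (log m ++ pend m) by rewrite (perm_uniq permA).
rewrite cat_uniq => /and3P[-> /hasPn h uP]; split=> // x hx.
- by rewrite -(perm_mem permA) mem_cat hx.
- by rewrite -(perm_mem permA) mem_cat hx orbT.
Qed.

Lemma arrive_reject_inv A Rj m x : x \notin A -> x \notin Rj ->
  uniq A -> ~~ accepts key eps kap w p m x ->
  inv A Rj m -> inv A (rcons Rj x) (arrive key eps kap w p r m x).
Proof.
move=> xA xR uA nacc I; rewrite /arrive nacc.
have [uL dLP sL sP] := inv_uniq uA I.
have rtx : rtime m x = None by rewrite (inv_rtime I) // (negbTE xR).
have rtA y : y \in A -> set_once (rtime m) x (r x) y = rtime m y.
  move=> yA; rewrite /set_once; case: (rtime m y) => //.
  by case: eqP => // yx; rewrite -yx yA in xA.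
have endA y : y \in A -> ends (MState (avail m) (pend m) (log m) (cnt m)
    (credit key eps kap w p m x) (stime m) (set_once (rtime m) x (r x))) y = ends m y.
  by move=> yA; rewrite /ends /= rtA.
split=> /=.
- exact: (inv_perm I).
- exact: (inv_unstarted I).
- move=> y yL; have [h1 h2 h3 h4 h5] := inv_started I yL.
  by rewrite endA ?rtA ?sL //; split.
- by move=> y yP; rewrite rtA ?sP // (inv_pend_rtime I).
- move=> y yA; rewrite /set_once (inv_rtime I) // mem_rcons inE.
  by case: eqP => [->|_] /=; case: ifP.
- move=> y z yL zL; rewrite endA ?sL //; exact: (inv_disjoint I).
- exact: (inv_release I).
- exact: (inv_base I).
- exact: (inv_hdf I).
- exact: (inv_wait I).
- rewrite big_seq_cond (eq_bigl (fun u => (u \in log m) && rtime m u)) -?big_seq_cond.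
    exact: (inv_abort I).
  by move=> u /=; case: (boolP (u \in log m)) => //= /sL uA'; rewrite rtA.
Qed.

Lemma arrive_reject_busy A Rj m x : x \notin A ->
  uniq A -> ~~ accepts key eps kap w p m x ->
  inv A Rj m -> busy A (r x) m -> busy A (r x) (arrive key eps kap w p r m x).
Proof.
move=> xA uA nacc I; rewrite /arrive nacc.
have [uL dLP sL sP] := inv_uniq uA I.
have rtA y : y \in A -> set_once (rtime m) x (r x) y = rtime m y.
  move=> yA; rewrite /set_once; case: (rtime m y) => //.
  by case: eqP => // yx; rewrite -yx yA in xA.
move=> B /= /B [s [u [h1 h2 h3 h4 [h5 h6]]]]; exists s, u.
have uA' : u \in A by apply: sL; rewrite h1 mem_rcons mem_head.
split=> //=; first by rewrite rtA.
split=> //; rewrite big_seq_cond (eq_bigl (fun u => (u \in log m) && rtime m u)) -?big_seq_cond //.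
by move=> v /=; case: (boolP (v \in log m)) => //= /sL vA'; rewrite rtA.
Qed.

Section Accept.
Variables (A Rj : seq T) (m : mstate R T) (x : T).
Hypothesis eps0 : 0 < eps.
Hypothesis xA : x \notin A.
Hypothesis xR : x \notin Rj.
Hypothesis uA : uniq A.
Hypothesis pA : {in A, forall y, 0 < p y}.
Hypothesis wA : {in A, forall y, 0 < w y}.
Hypothesis px : 0 < p x.
Hypothesis wx : 0 < w x.
Hypothesis rA : {in A, forall y, r y <= r x}.
Hypothesis acc : accepts key eps kap w p m x.
Hypothesis I : inv A Rj m.
Hypothesis B : busy A (r x) m.
Hypothesis idle : pend m = [::] \/ r x <= avail m.
Let m' := arrive key eps kap w p r m x.
Hypothesis npriorx : nprior x = size (log m).
Hypothesis residx : resid x = avail m' - r x.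
Hypothesis clockx : clock x = load (log m).

Lemma arrive_log : log m' = log m.
Proof. by rewrite /m' /arrive acc /=; do 2![case: ifP => //]. Qed.

Lemma arrive_pend : pend m' = x :: pend m.
Proof. by rewrite /m' /arrive acc /=; do 2![case: ifP => //]. Qed.

Lemma arrive_stime : stime m' = stime m.
Proof. by rewrite /m' /arrive acc /=; do 2![case: ifP => //]. Qed.

Let dis := inv_uniq uA I.

Lemma arrive_avail_ge : r x <= avail m'.
Proof.
rewrite /m' /arrive acc /=; case: ifP => //= h; case: ifP => //= _.
by apply/ltW; rewrite ltNge h.
Qed.

Lemma arrive_avail_pend y : y \in pend m -> avail m' <= avail m.
Proof.
move=> yP; have : r x <= avail m by case: idle yP => [->|].
by rewrite /m' /arrive acc /=; case: ifP => //= h; case: ifP.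
Qed.

Lemma arrive_rtime y : y \notin log m -> rtime m' y = rtime m y.
Proof.
move=> yL; rewrite /m' /arrive acc /=; case: ifP => //= h; case: ifP => //= _.
have [|s [u [h1 _]]] := B; first by rewrite ltNge h.
rewrite /set_once; case: (rtime m y) => //; case: eqP => // yu.
by rewrite yu h1 last_rcons mem_rcons mem_head in yL.
Qed.

(** An abort only shortens the execution of the last started job, the one running at [r x]; every
    earlier one has ended before that job began. *)
Lemma arrive_ends y : y \in log m ->
  ends m' y <= avail m' /\ ends m' y <= ends m y /\
  (forall t, rtime m' y = Some t -> begins m y <= t < begins m y + p y).
Proof.
move=> yL; have [_ _ _ h4 h5] := inv_started I yL.
rewrite /m' /arrive acc /=; case: ifP => /= h.
  by split; [apply: le_trans h4 h | split].
have [|s [u [e1 e2 e3 e4 _]]] := B; first by rewrite ltNge h.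
case: ifP => /= _; last by split.
have rx : r x < avail m by rewrite ltNge h.
rewrite /ends /= /set_once e1 last_rcons.
have [yu|yu] := eqVneq y u.
  rewrite yu e2 /= /begins /=; split=> //; split; first by rewrite -/(begins m u) e3 ltW.
  by move=> t [<-]; rewrite -/(begins m u) e3 rx ltW.
have -> : (match rtime m y with Some v' => Some v' | None => None end) = rtime m y.
  by case: (rtime m y).
split; last by split.
apply: le_trans (ltW e4); apply: (inv_disjoint I yL).
  by rewrite e1 mem_rcons mem_head.
have [+ _ _ _] := dis; rewrite e1 rcons_uniq => /andP[us _].
move: yL; rewrite e1 mem_rcons inE (negbTE yu) /= => ys.
by rewrite index_rcons_last // index_rcons_in // index_mem.
Qed.

Lemma arrive_inv : inv (rcons A x) Rj m'.
Proof.
have [uL dLP sL sP] := dis.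
have xL : x \notin log m by apply: contra xA => /sL.
have rtx : rtime m x = None by rewrite (inv_rtime I) // (negbTE xR).
split; rewrite ?arrive_log ?arrive_pend ?arrive_stime.
- rewrite -cat1s perm_catCA perm_sym perm_rcons /= perm_cons perm_sym.
  exact: (inv_perm I).
- exact: (inv_unstarted I).
- move=> y yL; have [h1 h2 h3 h4 h5] := inv_started I yL.
  have [e1 [e2 e3]] := arrive_ends yL.
  by rewrite /begins arrive_stime; split.
- move=> y; rewrite inE => /predU1P[->|yP]; first by rewrite arrive_rtime.
  by rewrite arrive_rtime ?dLP // (inv_pend_rtime I).
- move=> y; rewrite mem_rcons inE negb_or => /andP[_ yA].
  rewrite arrive_rtime ?(inv_rtime I) //; by apply: contra yA => /sL.
- move=> y z yL zL h; rewrite /begins arrive_stime.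
  have [_ [e2 _]] := arrive_ends yL.
  by apply: le_trans e2 _; apply: (inv_disjoint I).
- move=> y; rewrite inE => /predU1P[->|yP]; first exact: arrive_avail_ge.
  by apply: le_trans arrive_avail_ge; apply/rA/sP.
- move=> y; rewrite inE => /predU1P[->|yP].
    rewrite /clock_offset residx clockx; lra.
  apply: le_trans (inv_base I yP); exact: (arrive_avail_pend yP).
- move=> u k uL'; rewrite mem_rcons inE => /predU1P[->|kA].
    by rewrite npriorx leqNgt index_mem uL'.
  exact: (inv_hdf I).
(* The wait of [x] is zero unless [u] goes on running. Then it is at most [p u], and the slack in
   [busy] pays for it because [u] has survived the abort test. *)
- rewrite big_rcons /= residx.
  have W := inv_wait I.
  rewrite /m' /arrive acc /=; case: ifP => /= h; first by rewrite subrr; lra.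
  have [|s [u [e1 e2 e3 e4 [e5 _]]]] := B; first by rewrite ltNge h.
  case: ifP => /= h'; first by rewrite subrr; lra.
  move/negbT: h'; rewrite -ltNge e1 last_rcons => h'.
  have pu : 0 < p u by apply/pA/sL; rewrite e1 mem_rcons mem_head.
  have h6 : eps * (w x * (avail m - r x)) <= eps * (w x * p u).
    by rewrite ler_pM2l // ler_pM2l //; lra.
  have h7 : eps * (cnt m + w x) * p u <= w u * p u by rewrite ler_pM2r // ltW.
  rewrite e1 in e5; lra.
(* If [u] is aborted, its weight is at most [eps] times the weight accepted since its start, [x]
   included: the amount saved up in [busy] together with the share of [x]. *)
- rewrite big_rcons /=.
  have W := inv_abort I.
  have ewx : 0 < eps * w x by apply: mulr_gt0.
  rewrite /m' /arrive acc /=; case: ifP => /= h; first lra.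
  have [|s [u [e1 e2 e3 e4 [_ e5]]]] := B; first by rewrite ltNge h.
  case: ifP => /= h'; last by lra.
  move: h' e5; rewrite e1 last_rcons -cats1 !big_cat /= !big_cons !big_nil.
  have -> : isSome (set_once (rtime m) u (r x) u) by rewrite /set_once e2 eqxx.
  rewrite e2 /= => h'.
  rewrite big_seq_cond [X in _ -> X + _ <= _]big_seq_cond.
  under [X in _ -> X + _ <= _]eq_bigl => v.
    have -> : (v \in s) && isSome (set_once (rtime m) u (r x) v) = (v \in s) && isSome (rtime m v).
      case: (boolP (v \in s)) => //= vs.
      move: uL; rewrite e1 rcons_uniq => /andP[us _].
      rewrite /set_once; case: (rtime m v) => //; case: eqP => // vu.
      by rewrite -vu vs in us.
    over.
  lra.
Qed.

Lemma arrive_busy : busy (rcons A x) (r x) m'.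
Proof.
rewrite /busy arrive_log {2}/m' {1}/m' /arrive acc /=; case: ifP => /= h; first by rewrite ltxx.
case: ifP => /= h'; first by rewrite ltxx.
rewrite ltNge h => _.
have rx : r x < avail m by rewrite ltNge h.
have [|s [u [e1 e2 e3 e4 [e5 e6]]]] := B; first by rewrite ltNge h.
have -> : m' = MState (avail m) (x :: pend m) (log m) (cnt m + w x)
  (credit key eps kap w p m x) (stime m) (rtime m) by rewrite /m' /arrive acc /= h h'.
exists s, u; split=> //=.
have [uL dLP sL sP] := dis.
have pu : 0 < p u by apply/pA/sL; rewrite e1 mem_rcons mem_head.
have h6 : eps * (w x * (avail m - r x)) <= eps * (w x * p u).
  by rewrite ler_pM2l // ler_pM2l //; lra.
have qx : resid x = avail m - r x by rewrite residx /m' /arrive acc /= h h'.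
rewrite !big_rcons /= qx; split; lra.
Qed.

End Accept.

End Invariant.

(** * Starting order and clock *)

Section Static.
Variables (R : realFieldType) (T : eqType) (w p r : T -> R) (L : seq T).
Variables (nprior : T -> nat) (earlier_than : rel T).
Hypothesis L_uniq : uniq L.
Hypothesis p_gt0 : {in L, forall x, 0 < p x}.
Hypothesis w_gt0 : {in L, forall x, 0 < w x}.
Implicit Types (x y u k j : T).
Local Notation idx x := (index x L).

(** The clock at the start with index [n]. In the following, [present u k] means that [k] is pending
    when [u] starts, [u] itself included, and [waits j k] that [k] is pending when [j] arrives. *)
Definition pos n : R := \sum_(u <- L | (idx u < n)%N) p u.
Definition present u k := (nprior k <= idx u <= idx k)%N.
Definition wpend u : R := \sum_(k <- L | present u k) w k.
Definition waits j k := earlier_than k j && (nprior j <= idx k)%N.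
Definition log_cost j : R := \sum_(k <- L | waits j k) Num.min (w j * p k) (w k * p j).

Lemma posB i n : (i <= n)%N ->
  \sum_(u <- L | (i <= idx u < n)%N) p u = pos n - pos i.
Proof.
move=> h; rewrite /pos [X in _ = X - _](bigID (fun u => (idx u < i)%N)) /=.
have -> : \sum_(u <- L | (idx u < n)%N && (idx u < i)%N) p u =
  \sum_(u <- L | (idx u < i)%N) p u by apply: eq_bigl => u; lia.
rewrite addrAC subrr add0r; apply: eq_bigl => u; lia.
Qed.

Lemma pos_le i n : (i <= n)%N -> pos i <= pos n.
Proof.
move=> /posB h; rewrite -subr_ge0 -h big_seq_cond sumr_ge0 // => u /andP[/p_gt0 /ltW].
by [].
Qed.

Lemma pos0 : pos 0 = 0.
Proof. by rewrite /pos big_pred0_eq. Qed.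

Lemma pos_ge0 n : 0 <= pos n.
Proof. by rewrite -pos0 pos_le. Qed.

Lemma posS u : u \in L -> pos (idx u).+1 = pos (idx u) + p u.
Proof.
move=> uL; have /eqP := posB (leqnSn (idx u)); rewrite eq_sym subr_eq => /eqP ->.
rewrite addrC; congr (_ + _); rewrite big_mkcond (bigD1_seq u) ?L_uniq //= leqnn ltnSn /=.
rewrite big_seq_cond big1 ?addr0 // => v /andP[vL vu]; case: ifP => // h; case/eqP: vu.
by rewrite -(nth_index u vL) -[RHS](nth_index u uL); congr nth; lia.
Qed.

Lemma pos_take n : \sum_(u <- take n L) p u = pos n.
Proof.
rewrite /pos -{2}(cat_take_drop n L) big_cat /= [X in _ + X]big_seq_cond.
rewrite [X in _ + X]big_pred0 ?addr0; last first.
  move=> u; apply/negbTE/negP => /andP[ud]; move: L_uniq; rewrite -{1}(cat_take_drop n L) cat_uniq.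
  move=> /and3P[_ /hasPn h _]; have ut := h _ ud.
  rewrite -(cat_take_drop n L) index_cat (negbTE ut) size_take_min => h1.
  have : (0 < size (drop n L))%N by case: (drop n L) ud.
  rewrite size_drop; lia.
rewrite [RHS]big_seq_cond [LHS]big_seq_cond; apply: eq_bigl => u /=; rewrite andbT.
case: (boolP (u \in take n L)) => //= ut.
rewrite -(cat_take_drop n L) index_cat ut.
have := index_mem u (take n L); rewrite ut size_take_min => h; apply/esym; lia.
Qed.

Lemma telescope_pos (f : R -> R) :
  \sum_(u <- L) (f (pos (idx u).+1) - f (pos (idx u))) = f (pos (size L)) - f 0.
Proof.
have -> : \sum_(u <- L) (f (pos (idx u).+1) - f (pos (idx u))) =
    \sum_(0 <= i < size L) (f (pos i.+1) - f (pos i)).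
  case: L L_uniq => [|x0 s] U; first by rewrite big_nil big_geq.
  rewrite (big_nth x0); apply: eq_big_nat => i /andP[_ hi].
  by rewrite index_uniq.
by rewrite telescope_sumr // pos0.
Qed.

(** Integral of the pending weight over the clock. A job that arrives during an execution is counted
    from the end of that execution on. *)
Definition pend_work : R := \sum_(u <- L) p u * wpend u.

Hypothesis nprior_le : {in L, forall k, (nprior k <= idx k)%N}.
Hypothesis hdf : {in L &, forall u k, present u k -> w k * p u <= w u * p k}.

(* Of two jobs pending together the denser one starts first, so the other waits
   for it at the cost already paid by the later arrival of the two. *)
Lemma pend_work_le :
  {in L &, forall j k, j != k -> earlier_than j k || earlier_than k j} ->
  pend_work <= \sum_(j <- L) (log_cost j + w j * p j).
Proof.
move=> earlier_total2.
(* Pending work, arrival costs and own sizes become double sums. Doubling them and exchanging the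
   indices reduces the claim to one inequality for each pair of jobs. *)
pose X u k := if present u k then p u * w k else 0.
pose Y j k := if waits j k then Num.min (w j * p k) (w k * p j) else 0.
pose Z j k := if k == j then w j * p k else 0.
have eX : pend_work = \sum_(u <- L) \sum_(k <- L) X u k.
  by apply: eq_bigr => u _; rewrite /wpend mulr_sumr big_mkcond.
have eY : \sum_(j <- L) (log_cost j + w j * p j) = \sum_(j <- L) \sum_(k <- L) (Y j k + Z j k).
  rewrite big_seq [RHS]big_seq; apply: eq_bigr => j jL; rewrite big_split /= /log_cost big_mkcond; congr (_ + _).
  by rewrite /Z (bigD1_seq j) //= eqxx big1 ?addr0 // => k /negbTE ->.
have Y0 u k : u \in L -> k \in L -> 0 <= Y u k.
  move=> uL kL; rewrite /Y; case: ifP => // _.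
  by rewrite le_min !mulr_ge0 // ltW // ?p_gt0 ?w_gt0.
have XY u k : u \in L -> k \in L -> (idx u < idx k)%N ->
    X u k + X k u <= (Y u k + Z u k) + (Y k u + Z k u).
  move=> uL kL h; have uk : u != k by apply: contraTneq h => ->; rewrite ltnn.
  rewrite /Z [u == k]eq_sym eq_sym (negbTE uk) !addr0.
  have -> : X k u = 0 by rewrite /X /present [(idx k <= _)%N]leqNgt h andbF.
  rewrite addr0 {1}/X; case: ifP => pr; last by rewrite addr_ge0 // Y0.
  have hh := hdf uL kL pr.
  have [b|b] := orP (earlier_total2 _ _ uL kL uk).
    apply: (@le_trans _ _ (Y k u)); last by rewrite lerDr Y0.
    have /andP[h1 h2] := pr.
    by rewrite /Y /waits b h1 /= le_min [p u * _]mulrC lexx.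
  apply: (@le_trans _ _ (Y u k)); last by rewrite lerDl Y0.
  have h1 := nprior_le uL.
  rewrite /Y /waits b /= (leq_trans h1 (ltnW h)) le_min [p u * _]mulrC hh lexx //.
have XYd u k : u \in L -> k \in L ->
    X u k + X k u <= (Y u k + Z u k) + (Y k u + Z k u).
  move=> uL kL; case: (ltngtP (idx u) (idx k)) => h.
  - exact: XY.
  - by rewrite addrC [leRHS]addrC; apply: XY.
  have -> : k = u by rewrite -(nth_index u kL) -h nth_index.
  have -> : X u u = Z u u by rewrite /X /Z eqxx /present leqnn nprior_le // mulrC.
  by rewrite -lerBlDl; have := Y0 _ _ uL uL; lra.
have sym (F : T -> T -> R) : (\sum_(u <- L) \sum_(k <- L) F u k) *+ 2 =
    \sum_(u <- L) \sum_(k <- L) (F u k + F k u).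
  under [RHS]eq_bigr do rewrite big_split /=.
  by rewrite big_split /= [X in _ = _ + X]exchange_big /= mulr2n.
rewrite eX eY -(ler_pMn2r (ltn0Sn 1)) !sym big_seq [leRHS]big_seq; apply: ler_sum => u uL.
by rewrite big_seq [leRHS]big_seq; apply: ler_sum => k kL; exact: XYd.
Qed.

Lemma wpend_ge0 u : 0 <= wpend u.
Proof. by rewrite /wpend big_seq_cond sumr_ge0 // => k /andP[/w_gt0 /ltW]. Qed.

(** Of the jobs satisfying [P], take the one started last: all of them lie between index [i] and its
    own, a stretch of the clock of length at most [X]. The induction on [n] locates this job. *)
Lemma sum_initial_le (P : pred T) i X : 0 <= X ->
  {in L, forall k, P k -> (i <= idx k)%N /\ pos (idx k).+1 - pos i <= X} ->
  \sum_(k <- L | P k) p k <= X.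
Proof.
move=> X0 hP.
have main n : \sum_(k <- L | P k && (idx k < n)%N) p k <= X.
  elim: n => [|n IH]; first by rewrite big_pred0 // => k; rewrite ltn0 andbF.
  case: (boolP (has (fun k => P k && (idx k == n)) L)) => [/hasP[k kL /andP[Pk /eqP kn]]|/hasPn hn].
    have [h1 h2] := hP _ kL Pk.
    apply: le_trans h2; rewrite -posB; last lia.
    rewrite [leRHS](bigID P) /= -[leLHS]addr0 lerD //; last first.
      by rewrite big_seq_cond sumr_ge0 // => v /andP[/p_gt0 /ltW].
    rewrite [leLHS]big_seq_cond [leRHS]big_seq_cond le_eqVlt; apply/orP; left; apply/eqP.
    apply: eq_bigl => v; case: (boolP (v \in L)) => //= vL.
    by case: (boolP (P v)) => Pv; rewrite ?andbF //= andbT kn; have [-> _] := hP _ vL Pv.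
  rewrite [leLHS]big_seq_cond; apply: le_trans IH; rewrite [leRHS]big_seq_cond.
  rewrite le_eqVlt; apply/orP; left; apply/eqP; apply: eq_bigl => v.
  case: (boolP (v \in L)) => //= vL; case: (boolP (P v)) => //= Pv.
  by have := hn _ vL; rewrite Pv /= => h; rewrite ltnS leq_eqVlt (negbTE h).
have := main (size L); rewrite [leLHS]big_seq_cond (eq_bigl (fun k => (k \in L) && P k)) -?big_seq_cond //.
by move=> k; case: (boolP (k \in L)) => //=; rewrite -index_mem => ->; rewrite andbT.
Qed.

Variables (resid : T -> R).
Definition offset_of k : R := r k + resid k - pos (nprior k).
(* Upper bound on the completion time of [k]: as if aborted jobs had been run to
   their end. *)
Definition due k : R := offset_of k + pos (idx k).+1.

(** The minimum is bounded by its first argument for jobs due by [e] and by its second for the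
    others. The former run on the clock after index [nprior j], and by the hypothesis on offsets
    their total size is at most [e - r j]. *)
Lemma log_cost_le j e : 0 < w j -> 0 < p j -> r j <= e ->
  {in L, forall k, waits j k -> r j <= offset_of k + pos (nprior j)} ->
  log_cost j <= w j * (e - r j) + \sum_(k <- L | waits j k && (e < due k)) w k * p j.
Proof.
move=> wj pj rje hr.
rewrite /log_cost (bigID (fun k => e < due k)) /= addrC; apply: lerD; last first.
  by apply: ler_sum => k _; rewrite ge_min lexx orbT.
apply: (@le_trans _ _ (\sum_(k <- L | waits j k && ~~ (e < due k)) w j * p k)).
  by apply: ler_sum => k _; rewrite ge_min lexx.
rewrite -mulr_sumr ler_pM2l //; apply: (@sum_initial_le _ (nprior j)); first by rewrite subr_ge0.
move=> k kL /andP[wk]; rewrite -leNgt /due => h; split; first by case/andP: wk.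
have := hr _ kL wk; lra.
Qed.

(** On the clock, [k] is pending from [pos (nprior k)] to [pos (idx k).+1]. Exchanging the
    summations turns pending weights into these lengths, and [resid k] is the wait before the first
    of these moments. *)
Lemma due_sum : \sum_(k <- L) w k * (due k - r k) = pend_work + \sum_(k <- L) w k * resid k.
Proof.
rewrite /pend_work; under [X in _ = X + _]eq_bigr do rewrite /wpend mulr_sumr big_mkcond /=.
rewrite exchange_big /= -big_split /= big_seq [RHS]big_seq; apply: eq_bigr => k kL.
rewrite -big_mkcond /= -mulr_suml.
have e : \sum_(u <- L | present u k) p u = pos (idx k).+1 - pos (nprior k).
  exact: (posB (leq_trans (nprior_le kL) (leqnSn _))).
rewrite e /due /offset_of; ring.
Qed.

(** Projection onto [[a, b]]: its increments along the clock measure how much of an execution lies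
    in a window. *)
Definition clamp (a b t : R) : R := Num.min (Num.max t a) b.

Lemma clamp_mono (a b s t : R) : s <= t -> clamp a b s <= clamp a b t.
Proof.
rewrite /clamp => st; rewrite le_min ge_min ge_min lexx orbT andbT.
by rewrite ge_max le_max st /= le_max lexx orbT.
Qed.

Lemma clamp_lip (a b s t : R) : a <= b -> s <= t -> clamp a b t - clamp a b s <= t - s.
Proof.
move=> ab st; rewrite /clamp.
by case: (lerP s a) => h1; case: (lerP t a) => h2;
  case: (lerP a b) => h3; case: (lerP t b) => h4; case: (lerP s b) => h5; lra.
Qed.

Lemma clamp_diff_gt0 (a b s t : R) : a <= b -> s <= t -> 0 < clamp a b t - clamp a b s -> a < t /\ s < b.
Proof.
move=> ab st; rewrite /clamp.
by case: (lerP s a) => h1; case: (lerP t a) => h2;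
  case: (lerP a b) => h3; case: (lerP t b) => h4; case: (lerP s b) => h5;
  split; lra.
Qed.

(* [c u] is the part of the execution of [u] already claimed by shorter windows;
   these have total length at most a third of the current window. *)
Lemma windows_pack (K : seq R) (start v : R -> R) (c : T -> R) :
  {in K, forall a, [/\ 0 < a, 0 <= v a, 0 <= start a & start a + a / 2 <= pos (size L)]} ->
  {in K & L, forall a u, start a < pos (idx u).+1 -> pos (idx u) < start a + a / 2 ->
     v a <= wpend u} ->
  sorted (fun a b => 4 * a <= b) K ->
  {in L, forall u, 0 <= c u} ->
  (if K is a :: _ then \sum_(u <- L) c u <= a / 6 else True) ->
  \sum_(a <- K) v a * (a / 3) <= \sum_(u <- L) Num.max 0 (p u - c u) * wpend u.
Proof.
elim: K c => [|a K IH] c hK hW hs c0 hc.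
  rewrite big_nil big_seq sumr_ge0 // => u _.
  by rewrite mulr_ge0 ?wpend_ge0 // le_max lexx.
have [a0 va0 s0 send] := hK _ (mem_head _ _).
pose o u := clamp (start a) (start a + a / 2) (pos (idx u).+1)
  - clamp (start a) (start a + a / 2) (pos (idx u)).
have a2 : start a <= start a + a / 2 by lra.
have o0 u : 0 <= o u by rewrite subr_ge0 clamp_mono // pos_le.
have op u : u \in L -> o u <= p u.
  move=> uL; apply: (le_trans (clamp_lip a2 (pos_le (leqnSn _)))).
  by rewrite posS // addrAC subrr add0r.
have osum : \sum_(u <- L) o u = a / 2.
  rewrite /o telescope_pos /clamp.
  rewrite (max_l (_ : start a <= pos _)); last lra.
  rewrite (max_r s0) (min_r send) (min_l a2); lra.
have {}IH := IH (fun u => c u + o u).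
rewrite big_cons.
(* The unclaimed part of [u] is split into what the current window takes and what is left to the
   longer ones. *)
apply: (@le_trans _ _ (\sum_(u <- L) (Num.max 0 (o u - c u) * wpend u +
   Num.max 0 (p u - (c u + o u)) * wpend u))); last first.
  rewrite big_seq [leRHS]big_seq; apply: ler_sum => u uL.
  rewrite -mulrDl ler_wpM2r ?wpend_ge0 //.
  have h1 := o0 u; have h2 := op _ uL; have h3 := c0 _ uL.
  case: (lerP 0 (o u - c u)) => ?; case: (lerP 0 (p u - (c u + o u))) => ?;
    case: (lerP 0 (p u - c u)) => ?; lra.
rewrite big_split /=; apply: lerD; last first.
  apply: IH.
  - by move=> b hb; apply: hK; rewrite inE hb orbT.
  - by move=> b u hb; apply: hW; rewrite inE hb orbT.
  - exact: path_sorted hs.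
  - by move=> u uL; rewrite addr_ge0 ?c0.
  (* The claimed length is now at most [a / 6 + a / 2 = 2 * a / 3], which is at most [b / 6] because
     [b >= 4 * a]. *)
  - case: K hs {hK hW} => // b K /= /andP[hb _].
    rewrite big_split /= osum; lra.
apply: (@le_trans _ _ (\sum_(u <- L) v a * (o u - c u))).
  rewrite -mulr_sumr ler_wpM2l // sumrB osum; lra.
rewrite [leLHS]big_seq [leRHS]big_seq; apply: ler_sum => u uL.
have W0 := wpend_ge0 u.
case: (ltrP 0 (o u - c u)) => h; last by rewrite mul0r mulr_ge0_le0.
rewrite mulrC; apply: ler_wpM2l; first exact: ltW.
have op0 : 0 < o u by have := c0 _ uL; lra.
have [h1 h2] := clamp_diff_gt0 a2 (pos_le (leqnSn _)) op0.
exact: hW (mem_head _ _) uL h1 h2.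
Qed.

Lemma windows_sum (K : seq R) (start v : R -> R) :
  {in K, forall a, [/\ 0 < a, 0 <= v a, 0 <= start a & start a + a / 2 <= pos (size L)]} ->
  {in K & L, forall a u, start a < pos (idx u).+1 -> pos (idx u) < start a + a / 2 ->
     v a <= wpend u} ->
  sorted (fun a b => 4 * a <= b) K ->
  \sum_(a <- K) v a * (a / 3) <= pend_work.
Proof.
move=> h1 h2 h3; apply: le_trans (windows_pack (c := fun=> 0) h1 h2 h3 _ _) _ => //.
  case: K h1 {h2 h3} => // a K h1; rewrite big1 //.
  by have [] := h1 _ (mem_head _ _) => *; lra.
rewrite /pend_work big_seq [leRHS]big_seq; apply: ler_sum => u /p_gt0 pu.
by rewrite subr0 max_r // ltW.
Qed.

Hypothesis earlier_nprior : {in L, forall k j, earlier_than k j -> (nprior k <= nprior j)%N}.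

(** Split the jobs waiting at the arrival of [j] by whether they start before [u]. Those that do
    cost at most [w j] times the clock elapsed, which is below [a / 2], hence at most half of
    [log_cost j]. The others are present at [u] and cost at most [p j] times their weight. *)
Lemma wpend_window j a u : u \in L -> 0 < w j -> 0 < p j -> a * w j <= log_cost j ->
  pos (nprior j) < pos (idx u).+1 -> pos (idx u) < pos (nprior j) + a / 2 ->
  log_cost j / 2 <= p j * wpend u.
Proof.
move=> uL wj pj ha h1 h2.
have ju : (nprior j <= idx u)%N.
  by rewrite leqNgt; apply/negP => /pos_le; rewrite leNgt h1.
have : log_cost j <= w j * (pos (idx u) - pos (nprior j)) + p j * wpend u; last first.
  have : w j * (pos (idx u) - pos (nprior j)) <= w j * (a / 2) by rewrite ler_pM2l //; lra.
  lra.
rewrite /log_cost (bigID (fun k => idx k < idx u)%N) /=; apply: lerD.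
  rewrite -posB // mulr_sumr.
  apply: (@le_trans _ _ (\sum_(k <- L | waits j k && (idx k < idx u)%N) w j * p k)).
    by apply: ler_sum => k _; rewrite ge_min lexx.
  rewrite [leRHS](bigID (fun k => earlier_than k j)) /= -[leLHS]addr0; apply: lerD.
    by rewrite le_eqVlt; apply/orP; left; apply/eqP/eq_bigl => k; rewrite /waits; lia.
  rewrite big_seq_cond sumr_ge0 // => k /andP[/p_gt0 /ltW pk _].
  by rewrite mulr_ge0 // ltW.
rewrite /wpend mulr_sumr.
apply: (@le_trans _ _ (\sum_(k <- L | waits j k && ~~ (idx k < idx u)%N) p j * w k)).
  by apply: ler_sum => k _; rewrite [p j * _]mulrC ge_min lexx orbT.
rewrite [leLHS]big_seq_cond [leRHS]big_seq_cond big_mkcond [leRHS]big_mkcond.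
apply: ler_sum => k _; case: ifP => [/andP[kL /andP[/andP[kj _] hk]]|_].
  have := earlier_nprior kL kj; rewrite kL /present => h; have -> : (nprior k <= idx u <= idx k)%N by lia.
  by [].
by case: ifP => // /andP[/w_gt0 /ltW wk _]; rewrite mulr_ge0 // ltW.
Qed.

(** The waiting jobs all run from index [nprior j] on, so [log_cost j] is at most [w j] times the
    remaining clock. The second alternative covers an index beyond the end of [L], where nothing
    waits. *)
Lemma window_fits j a : 0 < w j -> a * w j <= log_cost j -> pos (nprior j) + a <= pos (size L) \/ log_cost j = 0.
Proof.
move=> wj ha.
case: (leqP (nprior j) (size L)) => hn; last first.
  right; rewrite /log_cost big_seq_cond big1 // => k /andP[kL /andP[_]].
  by rewrite leqNgt (leq_trans _ (ltnW hn)) ?index_mem // ltnS ltnW // (leq_ltn_trans _ hn).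
left; have : log_cost j <= w j * (pos (size L) - pos (nprior j)).
  rewrite -posB // mulr_sumr /log_cost.
  apply: (@le_trans _ _ (\sum_(k <- L | waits j k) w j * p k)).
    by apply: ler_sum => k _; rewrite ge_min lexx.
  rewrite big_seq_cond [leRHS]big_seq_cond big_mkcond [leRHS]big_mkcond.
  apply: ler_sum => k _; case: ifP => [/andP[kL /andP[_ h]]|_].
    by rewrite kL h index_mem kL.
  by case: ifP => // /andP[/p_gt0 /ltW pk _]; rewrite mulr_ge0 // ltW.
move=> h; have := le_trans ha h; rewrite mulrC ler_pM2l //; lra.
Qed.

End Static.

(** * Analysis of a run on one machine *)

Section Run.
Variables (R : realFieldType) (T : eqType) (key : R -> R) (eps kap : R).
Variables (w p r : T -> R) (a : pred T) (jl : seq T) (f0 : R).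
Hypothesis eps0 : 0 < eps.
Hypothesis eps1 : eps < 1.
Hypothesis kap0 : 0 < kap.
Hypothesis key_gt0 : forall x, 0 < x -> 0 < key x.
Hypothesis key_le : forall x, 0 < x -> key x <= x.
Hypothesis key_gt : forall x, 0 < x -> x < 4 * key x.
Hypothesis key_gap : forall x y, 0 < x -> 0 < y -> key x < key y -> 4 * key x <= key y.
Hypothesis jl_uniq : uniq jl.
Hypothesis jl_sorted : pairwise (fun x y => r x <= r y) jl.
Hypothesis p_gt0 : {in jl, forall x, 0 < p x}.
Hypothesis w_gt0 : {in jl, forall x, 0 < w x}.
Hypothesis f0_le : {in jl, forall x, f0 <= r x}.
Implicit Types (m : mstate R T) (x y u k : T) (s A : seq T) (c : pred R).

Definition init : mstate R T :=
  MState f0 [::] [::] 0 (fun=> 0) (fun=> None) (fun=> None).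

Definition pre n := foldl (step key eps kap w p r a) init (take n jl).
Definition arrival_state x := advance w p (fun t => t < r x) (pre (index x jl)).
Definition accepted x := a x && accepts key eps kap w p (arrival_state x) x.
Definition bounced x := a x && ~~ accepts key eps kap w p (arrival_state x) x.
Definition prior_starts x := size (log (arrival_state x)).
Definition arrival_clock x := load p (log (arrival_state x)).
Definition residual x := avail (arrive key eps kap w p r (arrival_state x) x) - r x.
Definition acc_upto n := [seq x <- take n jl | accepted x].
Definition bounced_upto n := [seq x <- take n jl | bounced x].
Definition final := finish w p (pre (size jl)).

Let invR := inv eps w p r prior_starts residual arrival_clock.
Let busyR := busy eps w p residual.

Lemma take_index_rconsE x : x \in jl ->
  take (index x jl).+1 jl = rcons (take (index x jl) jl) x.
Proof. by move=> h; rewrite (take_nth x) ?index_mem // nth_index. Qed.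

Lemma pre_step x : x \in jl ->
  pre (index x jl).+1 =
    if a x then arrive key eps kap w p r (arrival_state x) x else arrival_state x.
Proof.
by move=> h; rewrite /pre take_index_rconsE // foldl_rcons.
Qed.

Lemma mem_take_index x y n : x \in take n jl -> y \in drop n jl -> r x <= r y.
Proof.
move: jl_sorted; rewrite -{1}(cat_take_drop n jl) pairwise_cat => /and3P[/allrelP h _ _].
exact: h.
Qed.

Lemma notin_take_index x n : (n <= index x jl)%N -> x \notin take n jl.
Proof.
move=> h; apply/negP => hx.
have := hx; rewrite -index_mem size_take_min => h1.
have := index_cat x (take n jl) (drop n jl); rewrite cat_take_drop hx => e.
rewrite e in h; have := leq_ltn_trans h h1; rewrite ltnNge; case/negP.
exact: geq_minl.
Qed.

Lemma advance_inv A Rj m t c : uniq A -> {subset A <= jl} ->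
  (forall v, c v -> v < t) ->
  invR A Rj m -> busyR A t m ->
  invR A Rj (advance w p c m) /\ busyR A t (advance w p c m).
Proof.
move=> uA sA ct I B; apply: (@advance_ind _ _ w p (fun m' => invR A Rj m' /\ busyR A t m')); last by split.
move=> m' h1 h2 [I' B']; split.
  by apply: start_inv => // x /sA; [exact: p_gt0|exact: w_gt0].
have pA : {in A, forall x, 0 < p x} by move=> x /sA /p_gt0.
have wA : {in A, forall x, 0 < w x} by move=> x /sA /w_gt0.
exact: start_busy uA pA wA (ct _ h2) h1 I'.
Qed.

Lemma acc_upto_sub n : {subset acc_upto n <= jl}.
Proof. by move=> x; rewrite mem_filter => /andP[_ /mem_take]. Qed.

Lemma acc_upto_uniq n : uniq (acc_upto n).
Proof. by apply/filter_uniq/take_uniq. Qed.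

(** Induction over all arrivals, including those sent to other machines, at which this one only
    advances. [busy] is proved at the release of [x] and passes to all later releases, as they are
    sorted. *)
Lemma pre_inv n : (n <= size jl)%N ->
  invR (acc_upto n) (bounced_upto n) (pre n) /\
  (forall x, x \in drop n jl -> busyR (acc_upto n) (r x) (pre n)).
Proof.
elim: n => [_|n IH hn].
  rewrite /pre /acc_upto /bounced_upto take0 /=; split.
    by split; rewrite //= ?big_nil ?mulr0.
  move=> x /mem_drop /f0_le h; rewrite /busyR /busy /= => /lt_le_trans /(_ h).
  by rewrite ltxx.
have [I B] := IH (ltnW hn).
have [x0 _] : exists x, x \in jl by case: (jl) hn => // y ? _; exists y; rewrite mem_head.
pose x := nth x0 jl n.
have xjl : x \in jl by apply: mem_nth.
have ix : index x jl = n by apply: index_uniq.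
have xd : x \in drop n jl by rewrite (drop_nth x0) // mem_head.
have [I' B'] := advance_inv (c := fun t => t < r x) (@acc_upto_uniq n) (@acc_upto_sub n)
  (fun v h => h) I (B _ xd).
have xt : x \notin take n jl by rewrite notin_take_index ?ix.
have xacc : x \notin acc_upto n by rewrite mem_filter negb_and xt orbT.
have xbou : x \notin bounced_upto n by rewrite mem_filter negb_and xt orbT.
have eN : advance w p (fun t => t < r x) (pre n) = arrival_state x by rewrite /arrival_state ix.
rewrite eN in I' B'.
have := pre_step xjl; rewrite ix => ->.
have etake : take n.+1 jl = rcons (take n jl) x by rewrite -ix take_index_rconsE ?ix.
have mono y A m : y \in drop n.+1 jl -> busyR A (r x) m -> busyR A (r y) m.
  move=> yd; apply: busy_le; apply: (mem_take_index (n := n.+1)) => //.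
  by rewrite etake mem_rcons mem_head.
have exit := advance_exit w p (fun t => t < r x) (pre n); rewrite eN in exit.
have idle : pend (arrival_state x) = [::] \/ r x <= avail (arrival_state x).
  by rewrite leNgt.
rewrite /acc_upto /bounced_upto etake !filter_rcons -/(acc_upto n) -/(bounced_upto n).
rewrite /accepted /bounced; have [ax|/negbTE ax] := boolP (a x); rewrite /= ?ax; last first.
  split=> //; by move=> y yd; apply: mono.
have [hacc|hacc] /= := boolP (accepts key eps kap w p (arrival_state x) x); last first.
  split; first by apply: arrive_reject_inv; rewrite ?hacc // acc_upto_uniq.
  move=> y yd; apply: mono => //.
  by apply: arrive_reject_busy I' B'; rewrite ?hacc // acc_upto_uniq.
have rA : {in acc_upto n, forall y, r y <= r x}.
  by move=> y; rewrite mem_filter => /andP[_ yt]; apply: mem_take_index xd.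
have pA : {in acc_upto n, forall y, 0 < p y} by move=> y /acc_upto_sub /p_gt0.
have wA : {in acc_upto n, forall y, 0 < w y} by move=> y /acc_upto_sub /w_gt0.
split.
  by apply: arrive_inv => //; [exact: acc_upto_uniq|exact: w_gt0].
move=> y yd; apply: mono => //.
apply: arrive_busy I' B' _ => //; first exact: acc_upto_uniq.
exact: w_gt0.
Qed.

Lemma arrival_inv x : x \in jl ->
  invR (acc_upto (index x jl)) (bounced_upto (index x jl)) (arrival_state x) /\
  (pend (arrival_state x) = [::] \/ r x <= avail (arrival_state x)).
Proof.
move=> xjl; have hn : (index x jl <= size jl)%N by rewrite index_size.
have [I B] := pre_inv hn.
have xd : x \in drop (index x jl) jl by rewrite (drop_nth x) ?index_mem // nth_index ?mem_head.
have [I' _] := advance_inv (c := fun t => t < r x) (@acc_upto_uniq (index x jl)) (@acc_upto_sub (index x jl))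
  (fun v h => h) I (B _ xd).
split=> //; have := advance_exit w p (fun t => t < r x) (pre (index x jl)).
by rewrite leNgt.
Qed.

Lemma final_inv :
  invR [seq x <- jl | accepted x] [seq x <- jl | bounced x] final /\
  pend final = [::].
Proof.
have [I _] := pre_inv (leqnn _); split; last first.
  by case: (advance_exit w p xpredT (pre (size jl))).
have -> : [seq x <- jl | accepted x] = acc_upto (size jl) by rewrite /acc_upto take_size.
have -> : [seq x <- jl | bounced x] = bounced_upto (size jl) by rewrite /bounced_upto take_size.
apply: (@advance_ind _ _ w p (invR _ _)) => // m' h1 _ I'.
apply: start_inv I' => //; first exact: acc_upto_uniq.
  by move=> y /acc_upto_sub /p_gt0.
by move=> y /acc_upto_sub /w_gt0.
Qed.

Lemma advance_prefix c m : prefix (log m) (log (advance w p c m)).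
Proof.
apply: (@advance_ind _ _ w p (fun m' => prefix (log m) (log m'))); last exact: prefix_refl.
move=> m' h _ /prefix_trans; apply.
by have [u [_ _ ->]] := start_next_ex w p h; rewrite /= prefix_rcons.
Qed.

Lemma step_prefix m x : prefix (log m) (log (step key eps kap w p r a m x)).
Proof.
rewrite /step; case: ifP => _; last exact: advance_prefix.
rewrite /arrive; do 3![case: ifP => /= _; try exact: advance_prefix].
Qed.

Lemma foldl_prefix s m : prefix (log m) (log (foldl (step key eps kap w p r a) m s)).
Proof.
elim: s m => [|x s IH] m /=; first exact: prefix_refl.
exact: prefix_trans (step_prefix _ _) (IH _).
Qed.

(** Starts are only appended, so a log seen during the run is an initial segment of the final one
    and indices keep their meaning. *)
Lemma arrival_prefix x : x \in jl -> prefix (log (arrival_state x)) (log final).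
Proof.
move=> xjl; apply: prefix_trans (advance_prefix xpredT _).
have -> : pre (size jl) = foldl (step key eps kap w p r a) (pre (index x jl).+1) (drop (index x jl).+1 jl).
  by rewrite /pre take_size -{1}(cat_take_drop (index x jl).+1 jl) foldl_cat.
apply: prefix_trans (foldl_prefix _ _); rewrite pre_step //.
case: ifP => _; last exact: prefix_refl.
by rewrite /arrive; do 3![case: ifP => /= _; try exact: prefix_refl].
Qed.

Lemma cred_advance c m : cred (advance w p c m) = cred m.
Proof.
apply: (@advance_ind _ _ w p (fun m' => cred m' = cred m)) => //.
by move=> m' h _ <-; have [u [_ _ ->]] := start_next_ex w p h.
Qed.

Lemma cred_arrive m x : cred (arrive key eps kap w p r m x) = credit key eps kap w p m x.
Proof. by rewrite /arrive; do 3![case: ifP => //=]. Qed.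

Local Notation L := (log final).

Definition before x y := (index x jl < index y jl)%N.
Definition arrival_cost x := delay_cost w p (arrival_state x) x.
Definition long x := is_long kap w p (arrival_state x) x.
Definition lev x := level key w p (arrival_state x) x.

Local Notation waitsL := (waits L prior_starts before).
Local Notation dueL := (due p r L prior_starts residual).

Let fin_inv := final_inv.1.

Lemma log_perm : perm_eq L [seq x <- jl | accepted x].
Proof.
have := inv_perm fin_inv.
by rewrite final_inv.2 cats0.
Qed.

Lemma mem_log x : (x \in L) = accepted x && (x \in jl).
Proof. by rewrite (perm_mem log_perm) mem_filter. Qed.

Lemma log_uniq : uniq L.
Proof. by rewrite (perm_uniq log_perm) filter_uniq. Qed.

Lemma log_sub : {subset L <= jl}.
Proof. by move=> x; rewrite mem_log => /andP[]. Qed.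

Let pL : {in L, forall x, 0 < p x}. Proof. by move=> x /log_sub /p_gt0. Qed.
Let wL : {in L, forall x, 0 < w x}. Proof. by move=> x /log_sub /w_gt0. Qed.

Lemma arrival_log x : x \in jl -> log (arrival_state x) = take (prior_starts x) L.
Proof.
move=> /arrival_prefix.
by rewrite prefixE => /eqP <-.
Qed.

Lemma arrival_clockE x : x \in jl -> arrival_clock x = pos p L (prior_starts x).
Proof. by move=> xj; rewrite /arrival_clock /load arrival_log // pos_take // log_uniq. Qed.

(** The queue met by [x] can be read off the final log: an accepted job that arrived earlier is in
    it unless it is among the first [prior_starts x] starts. This gives the static analysis access
    to the arrival costs. *)
Lemma mem_arrival_pend x k : x \in jl ->
  (k \in pend (arrival_state x)) = (k \in L) && waitsL x k.
Proof.
move=> xj; have [I _] := arrival_inv xj.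
have permA := inv_perm I.
have [_ dLP sL sP] := inv_uniq (acc_upto_uniq _) I.
have := perm_mem permA k; rewrite mem_cat mem_filter.
rewrite /waits /before mem_log.
have [kj|kj] := boolP (k \in jl); last first.
  have -> : k \in take (index x jl) jl = false by apply/negP => /mem_take; apply/negP.
  by rewrite !andbF => /negbT; rewrite negb_or => /andP[_ /negbTE].
rewrite in_take // andbT.
have [ka|ka] /= := boolP (accepted k); last by move=> /negbT; rewrite negb_or => /andP[_ /negbTE].
have kL : k \in L by rewrite mem_log ka.
rewrite arrival_log // in_take //= => <-.
case: ltnP => /= h; last by rewrite andbT.
by apply/negP => /dLP; rewrite arrival_log // in_take // h.
Qed.

Lemma arrival_pend_uniq x : x \in jl -> uniq (pend (arrival_state x)).
Proof.
move=> xj; have [I _] := arrival_inv xj.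
have : uniq (log (arrival_state x) ++ pend (arrival_state x)).
  by rewrite (perm_uniq (inv_perm I)) acc_upto_uniq.
by rewrite cat_uniq => /and3P[].
Qed.

Lemma arrival_costE x : x \in jl -> arrival_cost x = log_cost w p L prior_starts before x.
Proof.
move=> xj; rewrite /arrival_cost /delay_cost /log_cost -[RHS]big_filter; apply: perm_big.
apply: uniq_perm; rewrite ?arrival_pend_uniq ?filter_uniq ?log_uniq // => k.
by rewrite mem_arrival_pend // mem_filter andbC.
Qed.

Lemma prior_starts_le : {in L, forall k, (prior_starts k <= index k L)%N}.
Proof.
move=> k kL; have kj := log_sub kL; rewrite leqNgt -in_take // -arrival_log //.
have [I _] := arrival_inv kj.
have [_ _ sL _] := inv_uniq (acc_upto_uniq _) I.
by apply/negP => /sL; rewrite mem_filter in_take // ltnn andbF.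
Qed.

Lemma pre_prefix n n' : (n <= n')%N -> prefix (log (pre n)) (log (pre n')).
Proof.
move=> h; rewrite /pre -(subnKC h) takeD foldl_cat; exact: foldl_prefix.
Qed.

Lemma prior_starts_mono x y : x \in jl -> before x y -> (prior_starts x <= prior_starts y)%N.
Proof.
move=> xj xy; apply: size_prefix.
apply: prefix_trans (advance_prefix _ _).
apply: prefix_trans (pre_prefix xy); rewrite pre_step //.
case: ifP => _; last exact: prefix_refl.
by rewrite /arrive; do 3![case: ifP => /= _; try exact: prefix_refl].
Qed.

Lemma log_hdf : {in L &, forall u k, present L prior_starts u k -> w k * p u <= w u * p k}.
Proof.
move=> u k uL kL /andP[h1 h2]; apply: (inv_hdf fin_inv) => //.
by rewrite -(perm_mem log_perm).
Qed.

Lemma release_waits x k : x \in jl -> k \in L -> waitsL x k ->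
  r x <= offset_of p r L prior_starts residual k + pos p L (prior_starts x).
Proof.
move=> xj kL wk; have [I idle] := arrival_inv xj.
have kP : k \in pend (arrival_state x) by rewrite mem_arrival_pend // kL.
have rx : r x <= avail (arrival_state x) by case: idle kP => [->|].
apply: (le_trans rx); have := inv_base I kP.
by rewrite /clock_offset /load arrival_log // pos_take ?log_uniq // arrival_clockE // log_sub.
Qed.

Lemma begins_due x : x \in L ->
  [/\ stime final x = Some (begins final x), r x <= begins final x &
     begins final x + p x <= dueL x].
Proof.
move=> xL; have [h1 h2 h3 _ _] := inv_started fin_inv xL; split=> //.
rewrite /due posS ?log_uniq // addrA lerD2r; apply: le_trans h3 _.
by rewrite /clock_offset /load pos_take ?log_uniq // arrival_clockE // log_sub.
Qed.

Lemma before_total : {in L &, forall j k, j != k -> before j k || before k j}.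
Proof.
move=> j k jL kL; rewrite /before; case: ltngtP => //= h.
by rewrite -(nth_index j (log_sub jL)) h nth_index ?log_sub // eqxx.
Qed.

Local Notation P := (pend_work w p L prior_starts).

Lemma pend_work_arrival_cost : P <= \sum_(j <- L) (arrival_cost j + w j * p j).
Proof.
have -> : \sum_(j <- L) (arrival_cost j + w j * p j) =
    \sum_(j <- L) (log_cost w p L prior_starts before j + w j * p j).
  by rewrite big_seq [RHS]big_seq; apply: eq_bigr => j /log_sub /arrival_costE ->.
by apply: pend_work_le before_total; [exact: log_uniq|..|exact: prior_starts_le|exact: log_hdf].
Qed.

Lemma due_cost :
  eps * (\sum_(k <- L) w k * (dueL k - r k)) <=
  eps * (\sum_(j <- L) (arrival_cost j + w j * p j)) + \sum_(j <- L) w j * p j.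
Proof.
rewrite due_sum ?log_uniq //; last exact: prior_starts_le.
rewrite mulrDr; apply: lerD; first by rewrite ler_pM2l // pend_work_arrival_cost.
by rewrite (perm_big _ log_perm); exact: (inv_wait fin_inv).
Qed.

Lemma arrival_cost_le j e : j \in jl -> r j <= e ->
  arrival_cost j <= w j * (e - r j) + \sum_(k <- L | waitsL j k && (e < dueL k)) w k * p j.
Proof.
move=> jj re; rewrite arrival_costE //; apply: log_cost_le; rewrite ?log_uniq ?w_gt0 ?p_gt0 //.
by move=> k kL wk; apply: release_waits.
Qed.

Lemma waits_release x k : x \in jl -> k \in L -> waitsL x k -> r k <= r x.
Proof.
move=> xj kL /andP[b _].
apply: (mem_take_index (n := index x jl)).
  by rewrite in_take ?log_sub.
by rewrite (drop_nth x) ?index_mem // nth_index ?mem_head.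
Qed.

Lemma arrival_cost_gt0 x : x \in jl -> long x -> 0 < arrival_cost x.
Proof.
move=> xj; apply: le_lt_trans; rewrite !mulr_ge0 // ltW //; [exact: w_gt0|exact: p_gt0].
Qed.

Lemma lev_bounds x : x \in jl -> long x ->
  [/\ 0 < lev x, lev x * w x <= arrival_cost x & arrival_cost x < 4 * (lev x * w x)].
Proof.
move=> xj lx; have l0 := arrival_cost_gt0 xj lx; have wx := w_gt0 xj.
have q0 : 0 < arrival_cost x / w x by rewrite divr_gt0.
split; first exact: key_gt0.
  by rewrite -ler_pdivlMr // key_le.
by rewrite mulrA -ltr_pdivrMr // key_gt.
Qed.

Definition levels := undup [seq lev x | x <- jl & a x && long x].

Lemma sum_update (K : seq R) (F c : R -> R) b d : uniq K -> b \in K ->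
  \sum_(e <- K) F e * (if e == b then c e + d else c e) =
  \sum_(e <- K) F e * c e + F b * d.
Proof.
move=> uK bK; rewrite (bigD1_seq b) //= [in RHS](bigD1_seq b) //= eqxx.
rewrite mulrDr addrAC; congr (_ + _ + _); apply: eq_bigr => e /negbTE -> //.
Qed.

Lemma credit_step x : x \in jl -> a x ->
  cred (pre (index x jl).+1) =
  if long x then fun b => if b == lev x then
     cred (pre (index x jl)) b + (eps * w x - (if bounced x then w x else 0))
     else cred (pre (index x jl)) b
  else cred (pre (index x jl)).
Proof.
move=> xj ax; rewrite pre_step // ax cred_arrive /credit -/(long x) -/(lev x).
have -> : cred (arrival_state x) = cred (pre (index x jl)) by exact: cred_advance.
case: ifP => // lx; rewrite /bounced ax /=.
by case: ifP.
Qed.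

Lemma bouncedE x : bounced x = a x && long x && (w x <= cred (pre (index x jl)) (lev x) + eps * w x).
Proof.
rewrite /bounced /accepts negbK -/(long x) -/(lev x) andbA.
by rewrite (_ : cred (arrival_state x) = cred (pre (index x jl))) //; exact: cred_advance.
Qed.

Definition backs (s : seq T) b x :=
  [&& x \in s, accepted x, long x & lev x == b].

(* Credit at level [b] is worth [b] per unit: a long arrival earns [eps w_x] units,
   and a rejection spends [w_x] units for a gain of at least [b w_x]. *)
Lemma credit_inv n : (n <= size jl)%N ->
  [/\ eps * (\sum_(x <- take n jl | a x && long x) arrival_cost x) <=
        4 * (\sum_(x <- take n jl | bounced x) arrival_cost x +
             \sum_(b <- levels) b * cred (pre n) b),
      \sum_(b <- levels) 1 * cred (pre n) b + \sum_(x <- take n jl | bounced x) w x <=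
        eps * (\sum_(x <- take n jl | a x) w x) &
      forall b, 0 <= cred (pre n) b /\
        (cred (pre n) b = 0 \/ exists2 x, backs (take n jl) b x & cred (pre n) b <= w x)].
Proof.
elim: n => [_|n IH hn].
  rewrite take0 !big_nil !mulr0 add0r addr0 /pre take0 /=; split.
  - by rewrite mulr_ge0 // sumr_ge0 // => b _; rewrite mulr0.
  - by rewrite big1 // => b _; rewrite mulr0.
  - by move=> b; split=> //; left.
have [I1 I2 I3] := IH (ltnW hn).
have [x0 _] : exists x, x \in jl by case: (jl) hn => // y ? _; exists y; rewrite mem_head.
pose x := nth x0 jl n.
have xj : x \in jl by apply: mem_nth.
have ix : index x jl = n by apply: index_uniq.
have et : take n.+1 jl = rcons (take n jl) x by rewrite -ix take_index_rconsE ?ix.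
have wx := w_gt0 xj.
have mono b y : backs (take n jl) b y -> backs (take n.+1 jl) b y.
  by case/and4P => h1 h2 h3 h4; apply/and4P; split; rewrite // et mem_rcons inE h1 orbT.
rewrite {1 2 3 4}et -!cats1 !big_cat /= !big_cons !big_nil.
have [ax|ax] := boolP (a x); last first.
  rewrite /bounced (negbTE ax) /= !addr0 -/bounced.
  have -> : cred (pre n.+1) = cred (pre n).
    have := pre_step xj; rewrite (negbTE ax) ix => ->.
    by rewrite /arrival_state cred_advance ix.
  split=> // b; have [h1 h2] := I3 b; split=> //.
  by case: h2 => [->|[y /mono hy le]]; [left|right; exists y].
have := credit_step xj ax; rewrite ix => ->.
have := bouncedE x; rewrite ix ax /=.
have [lx|lx] := boolP (long x) => /= eb; last first.
  rewrite eb !addr0; split=> //.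
    have : 0 < eps * w x by rewrite mulr_gt0.
    by rewrite mulrDr; lra.
  move=> b; have [h1 h2] := I3 b; split=> //.
  by case: h2 => [->|[y /mono hy le]]; [left|right; exists y].
have lK : lev x \in levels.
  by rewrite mem_undup; apply/mapP; exists x; rewrite // mem_filter ax lx.
have [k1 k2 k3] := lev_bounds xj lx.
rewrite !sum_update ?undup_uniq //.
have ewx : 0 < eps * w x by rewrite mulr_gt0.
(* Rounding the delay down to [lev x] loses a factor of at most 4, the constant of the first
   clause. *)
have h4 : eps * arrival_cost x <= 4 * (lev x * (eps * w x)).
  rewrite (_ : 4 * _ = eps * (4 * (lev x * w x))); last ring.
  by rewrite ler_pM2l // ltW.
have [c0 cc] := I3 (lev x).
have [bx|bx] := boolP (bounced x); rewrite ?addr0; split.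
- have : lev x * w x * 4 <= arrival_cost x * 4 by rewrite ler_pM2r.
  by move=> h; lra.
- lra.
- rewrite bx in eb.
  have cw : w x <= cred (pre n) (lev x) + eps * w x by rewrite -eb.
  move=> b; case: eqP => [->|_]; last first.
    have [h1 h2] := I3 b; split=> //.
    by case: h2 => [->|[y /mono hy le]]; [left|right; exists y].
  (* A rejection lowers the credit since [eps < 1], so the job that backed it before still does.
     With credit 0 the rejection could not have been paid for. *)
  have ew1 : eps * w x < w x by rewrite gtr_pMl.
  split; first by lra.
  case: cc => [e0|[y /mono hy le]]; first lra.
  by right; exists y => //; lra.
- rewrite subr0; lra.
- rewrite subr0; lra.
- have cw : cred (pre n) (lev x) + eps * w x < w x by rewrite ltNge -eb.
  move=> b; case: eqP => [->|_]; last first.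
    have [h1 h2] := I3 b; split=> //.
    by case: h2 => [->|[y /mono hy le]]; [left|right; exists y].
  rewrite subr0; split; first by lra.
  right; exists x; last exact: ltW.
  apply/and4P; split; rewrite // ?et ?mem_rcons ?mem_head //.
  rewrite /accepted ax /=; move: bx; rewrite /bounced ax /= negbK //.
Qed.

Lemma levels_gap : {in levels &, forall b e : R, b < e -> 4 * b <= e}.
Proof.
move=> b e; rewrite !mem_undup => /mapP[x + ->] /mapP[y + ->].
rewrite !mem_filter => /andP[/andP[_ lx] xj] /andP[/andP[_ ly] yj].
by apply: key_gap; rewrite divr_gt0 ?arrival_cost_gt0 ?w_gt0.
Qed.

Lemma pend_work_ge0 : 0 <= P.
Proof.
rewrite /pend_work big_seq sumr_ge0 // => u /pL /ltW pu.
by rewrite mulr_ge0 // wpend_ge0.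
Qed.

(** The credit left at level [b] is at most the weight of one long job of that level. For a clock
    length of [b / 2] after its arrival the queue weighs at least [kap / 2] times as much as that
    job, by [wpend_window] and because the job is long. Packing these windows bounds [kap / 6] times
    the sum by [P]. *)
Lemma level_sum_le :
  \sum_(b <- levels) b * cred (pre (size jl)) b <= 6 / kap * P.
Proof.
pose c := cred (pre (size jl)); rewrite -/c.
have [_ _] := credit_inv (leqnn _); rewrite take_size -/c => C.
pose K := sort <=%R [seq b <- levels | c b != 0].
have memK b : (b \in K) = (c b != 0) && (b \in levels) by rewrite mem_sort mem_filter.
have uK : uniq K by rewrite sort_uniq filter_uniq ?undup_uniq.
have [E|[x0 _]] : levels = [::] \/ exists x : T, True.
  by rewrite /levels; case: (jl) => [|x0 s]; [left|right; exists x0].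
  by rewrite E big_nil mulr_ge0 ?pend_work_ge0 // divr_ge0 // ltW.
pose good b x := backs jl b x && (c b <= w x).
pose backer b := nth x0 jl (find (good b) jl).
have backerP b : b \in K -> [/\ backer b \in jl, long (backer b), lev (backer b) = b & c b <= w (backer b)].
  rewrite memK => /andP[/eqP cb _]; have [_ [//|[x bx le]]] := C b.
  have h : has (good b) jl.
    by apply/hasP; exists x; [by case/and4P: bx | rewrite /good bx].
  have /andP[/and4P[h1 _ h3 /eqP h4] h5] := nth_find x0 h.
  by split.
have PK : \sum_(b <- K) kap / 2 * w (backer b) * (b / 3) <= P.
  apply: (@windows_sum _ _ w p L prior_starts log_uniq pL wL K (fun b => pos p L (prior_starts (backer b)))).
  - move=> b /backerP[jj lj lb _]; have [b0 b1 _] := lev_bounds jj lj; rewrite lb in b0 b1.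
    have wj := w_gt0 jj; split=> //.
    + by apply: mulr_ge0; [apply: divr_ge0 => //; exact: ltW | exact: ltW].
    + exact: (pos_ge0 log_uniq pL).
    + rewrite arrival_costE // in b1.
      have [h|h] := window_fits log_uniq pL wj b1; first by lra.
      by have := arrival_cost_gt0 jj lj; rewrite arrival_costE // h ltxx.
  - move=> b u /backerP[jj lj lb _] uL h1 h2; have [b0 b1 _] := lev_bounds jj lj; rewrite lb in b0 b1.
    have wj := w_gt0 jj; have pj := p_gt0 jj.
    rewrite arrival_costE // in b1.
    have bn : {in L, forall k j, before k j -> (prior_starts k <= prior_starts j)%N}.
      by move=> k kL j; apply: prior_starts_mono; exact: log_sub.
    have := wpend_window log_uniq pL wL bn uL wj pj b1 h1 h2.
    rewrite -arrival_costE //; move: lj; rewrite /long /is_long -/(arrival_cost _) => lj h3.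
    rewrite -(ler_pM2l pj); lra.
  - apply: pairwise_sorted; have : pairwise <%R K.
      by rewrite -(sorted_pairwise lt_trans) sort_lt_sorted filter_uniq ?undup_uniq.
    apply: (sub_in_pairwise (P := mem levels)); first exact: levels_gap.
    by apply/allP => b; rewrite memK => /andP[].
have -> : \sum_(b <- levels) b * c b = \sum_(b <- K) b * c b.
  rewrite [RHS](perm_big [seq b <- levels | c b != 0]) /=; last by rewrite perm_sort.
  rewrite big_filter.
  rewrite [RHS]big_mkcond; apply: eq_bigr => b _; case: eqP => //= ->; exact: mulr0.
apply: (@le_trans _ _ (\sum_(b <- K) b * w (backer b))).
  rewrite big_seq [leRHS]big_seq; apply: ler_sum => b bK.
  have [jj lj lb le] := backerP _ bK; have [b0 _ _] := lev_bounds jj lj.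
  by rewrite ler_pM2l // -lb.
have h : 0 <= 6 / kap by rewrite divr_ge0 // ltW.
apply: le_trans (ler_wpM2l h PK); rewrite mulr_sumr le_eqVlt; apply/orP; left; apply/eqP.
apply: eq_bigr => b _; field; exact: lt0r_neq0.
Qed.

Lemma sum_assigned (F : T -> R) :
  \sum_(x <- jl | a x) F x = \sum_(x <- L) F x + \sum_(x <- jl | bounced x) F x.
Proof.
rewrite (perm_big _ log_perm) /= big_filter (bigID accepted) /=; congr (_ + _);
  apply: eq_bigl => x; rewrite /accepted /bounced; by case: (a x).
Qed.

Lemma due_total : eps * (\sum_(k <- L) w k * (dueL k - r k)) <=
  eps * (\sum_(x <- jl | a x) arrival_cost x - \sum_(x <- jl | bounced x) arrival_cost x)
  + 2 * \sum_(x <- jl | a x) w x * p x.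
Proof.
have := due_cost; rewrite !sum_assigned addrK big_split /= => h.
apply: (le_trans h); rewrite mulrDr -addrA lerD2l.
have h1 : 0 <= \sum_(x <- jl | bounced x) w x * p x.
  rewrite big_seq_cond sumr_ge0 // => x /andP[xj _].
  by rewrite mulr_ge0 // ltW ?w_gt0 ?p_gt0.
have h2 : 0 <= \sum_(x <- L) w x * p x.
  rewrite big_seq_cond sumr_ge0 // => x /andP[xj _].
  by rewrite mulr_ge0 // ltW ?wL ?pL.
have : eps * (\sum_(x <- L) w x * p x) <= \sum_(x <- L) w x * p x.
  by rewrite ler_piMl // ltW.
lra.
Qed.

(** With this [kap] the unspent credit costs at most [4 * (eps / 8) * P], and [P] is at most the
    arrival costs plus the weighted sizes, so half of the left side is absorbed. Jobs that are not
    long contribute [eps * kap = 48] times the weighted sizes. Doubling gives [2 * (48 + 1/2) = 97],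
    rounded up to 98. *)
Lemma arrival_cost_total : kap = 48 / eps ->
  eps * \sum_(x <- jl | a x) arrival_cost x <=
  8 * \sum_(x <- jl | bounced x) arrival_cost x + 98 * \sum_(x <- jl | a x) w x * p x.
Proof.
move=> ekap; have [I _ _] := credit_inv (leqnn _); rewrite !take_size in I.
have V := level_sum_le; have W := pend_work_arrival_cost; rewrite big_split /= in W.
have l0 x : x \in jl -> 0 <= arrival_cost x.
  move=> xj; rewrite arrival_costE // /log_cost big_seq_cond sumr_ge0 // => k /andP[kL _].
  by rewrite le_min; apply/andP; split; apply: mulr_ge0; apply/ltW; auto.
have ek : 6 / kap = eps / 8 by rewrite ekap; field; exact: lt0r_neq0.
rewrite ek in V.
have S : \sum_(x <- jl | a x) arrival_cost x <=
    \sum_(x <- jl | a x && long x) arrival_cost x + kap * \sum_(x <- jl | a x) w x * p x.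
  rewrite (bigID long) /= lerD2l.
  apply: (@le_trans _ _ (\sum_(x <- jl | a x && ~~ long x) kap * (w x * p x))).
    by apply: ler_sum => x /andP[_]; rewrite /long /is_long -leNgt.
  rewrite -mulr_sumr ler_wpM2l ?(ltW kap0) // [leRHS](bigID long) /= lerDr.
  rewrite big_seq_cond sumr_ge0 // => x /andP[xj _].
  by rewrite mulr_ge0 // ltW ?w_gt0 ?p_gt0.
have {}S : eps * \sum_(x <- jl | a x) arrival_cost x <=
    eps * \sum_(x <- jl | a x && long x) arrival_cost x + 48 * \sum_(x <- jl | a x) w x * p x.
  have := ler_wpM2l (ltW eps0) S; rewrite mulrDr ekap mulrA.
  by rewrite (_ : eps * (48 / eps) = 48) //; field; exact: lt0r_neq0.
have A1 : \sum_(x <- L) arrival_cost x <= \sum_(x <- jl | a x) arrival_cost x.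
  rewrite sum_assigned lerDl big_seq_cond sumr_ge0 // => x /andP[xj _]; exact: l0.
have A2 : \sum_(x <- L) w x * p x <= \sum_(x <- jl | a x) w x * p x.
  rewrite sum_assigned lerDl big_seq_cond sumr_ge0 // => x /andP[xj _].
  by rewrite mulr_ge0 // ltW ?w_gt0 ?p_gt0.
have A0 : 0 <= \sum_(x <- L) w x * p x.
  rewrite big_seq_cond sumr_ge0 // => x /andP[xj _].
  by rewrite mulr_ge0 // ltW ?wL ?pL.
have Q : eps * P <= eps * \sum_(x <- jl | a x) arrival_cost x + \sum_(x <- jl | a x) w x * p x.
  apply: (le_trans (ler_wpM2l (ltW eps0) (le_trans W (lerD A1 A2)))).
  rewrite mulrDr lerD2l ler_piMl ?(ltW eps1) //; exact: le_trans A2.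
lra.
Qed.

Lemma due_ge x : x \in L -> r x <= dueL x.
Proof.
move=> xL; have [_ h1 h2] := begins_due xL; have := pL xL; lra.
Qed.

(** One share of [eps] pays for rejections on arrival, since credits stay nonnegative; the other
    pays for aborts, by [inv_abort]. *)
Lemma rejected_total :
  \sum_(x <- jl | bounced x) w x + \sum_(x <- L | rtime final x) w x
  <= 2 * eps * \sum_(x <- jl | a x) w x.
Proof.
have [_ I C] := credit_inv (leqnn _); rewrite !take_size in I.
have c0 : 0 <= \sum_(b <- levels) 1 * cred (pre (size jl)) b.
  by apply: sumr_ge0 => b _; rewrite mul1r; case: (C b).
have J := inv_abort fin_inv; rewrite -(perm_big _ log_perm) /= in J.
have B0 : 0 <= \sum_(x <- jl | bounced x) w x.
  by rewrite big_seq_cond sumr_ge0 // => x /andP[/w_gt0 /ltW].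
have : eps * \sum_(x <- L) w x <= eps * \sum_(x <- jl | a x) w x.
  by rewrite ler_pM2l // sum_assigned lerDl.
lra.
Qed.

Lemma final_bounced x : x \in jl -> bounced x ->
  stime final x = None /\ rtime final x = Some (r x).
Proof.
move=> xj bx.
have nacc : accepted x = false.
  by move: bx; rewrite /bounced /accepted => /andP[-> /negbTE].
split; first by apply: (inv_unstarted fin_inv); rewrite mem_log nacc.
by rewrite (inv_rtime fin_inv) mem_filter ?nacc // bx xj.
Qed.

Lemma final_unstarted x : x \notin L -> stime final x = None.
Proof. exact: (inv_unstarted fin_inv). Qed.

Lemma final_aborted x t : x \in L -> rtime final x = Some t ->
  begins final x <= t < begins final x + p x.
Proof. by move=> /(inv_started fin_inv)[_ _ _ _]; apply. Qed.

Lemma final_disjoint x y t : x \in L -> y \in L ->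
  begins final x <= t < ends p final x -> begins final y <= t < ends p final y -> x = y.
Proof.
move=> xL yL /andP[x1 x2] /andP[y1 y2].
case: (ltngtP (index x L) (index y L)) => h.
- exfalso; have := inv_disjoint fin_inv xL yL h; lra.
- exfalso; have := inv_disjoint fin_inv yL xL h; lra.
by rewrite -(nth_index x xL) h nth_index.
Qed.

End Run.

(** * Decisions do not depend on the future *)

Section Causality.
Variables (R : realFieldType) (T : eqType) (key : R -> R) (eps kap : R).
Variables (w p r : T -> R).
Implicit Types (m : mstate R T) (x y u k : T) (s : seq T).

Definition cut (t : R) (o : option R) : option R :=
  if o is Some v then if v <= t then Some v else None else None.

Definition same_upto t m m' := forall y,
  cut t (stime m y) = cut t (stime m' y) /\ cut t (rtime m y) = cut t (rtime m' y).

(** Every start up to time [t] has been made: as long as further arrivals come after [t], so does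
    whatever the machine does next. *)
Definition settled t m :=
  (pend m = [::] \/ t < avail m) /\ {in pend m, forall x, 0 < p x}.

Lemma cut_set_once t (f : T -> option R) x v y : t < v ->
  cut t (set_once f x v y) = cut t (f y).
Proof.
move=> tv; rewrite /set_once; case: (f y) => // ; case: eqP => //= _.
by rewrite leNgt tv.
Qed.

Lemma same_upto_trans t m1 m2 m3 :
  same_upto t m1 m2 -> same_upto t m2 m3 -> same_upto t m1 m3.
Proof. by move=> h1 h2 y; have [-> ->] := h1 y. Qed.

Lemma start_settled t m : pend m != [::] -> settled t m ->
  settled t (start_next w p m) /\ same_upto t (start_next w p m) m.
Proof.
move=> hm [h1 h2]; have [u [up _ ->]] := start_next_ex w p hm.
have tm : t < avail m by case: h1 hm => // ->.
split; last by move=> y /=; rewrite cut_set_once.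
split=> /=; first by right; rewrite (lt_le_trans tm) // lerDl ltW // h2.
by move=> x /mem_rem; exact: h2.
Qed.

Lemma advance_settled t c m : settled t m ->
  settled t (advance w p c m) /\ same_upto t (advance w p c m) m.
Proof.
move=> h; apply: (@advance_ind _ _ w p (fun m' => settled t m' /\ same_upto t m' m)).
  move=> m' h1 _ [h2 h3]; have [h4 h5] := start_settled h1 h2.
  by split=> //; apply: same_upto_trans h3.
by split.
Qed.

Lemma step_settled t a m x : t < r x -> 0 < p x -> settled t m ->
  settled t (step key eps kap w p r a m x) /\
  same_upto t (step key eps kap w p r a m x) m.
Proof.
move=> tx px sm; rewrite /step; case: ifP => _; last exact: advance_settled.
have [] := advance_settled (fun v => v < r x) sm.
set m' := advance _ _ _ _ => -[h1 h2] h3.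
have px' : {in x :: pend m', forall y, 0 < p y}.
  by move=> y; rewrite inE => /predU1P[->|/h2].
rewrite /arrive; case: ifP => _.
  split; first by split.
  apply: same_upto_trans h3 => y; split=> //=; exact: cut_set_once.
case: ifP => /= hr; first by split=> //; split=> //; right.
have rx : t < avail m' by apply: lt_trans tx _; rewrite ltNge hr.
case: ifP => /= _; last by split=> //; split=> //; right.
split; first by split=> //; right.
apply: same_upto_trans h3 => y; split=> //=; exact: cut_set_once.
Qed.

Lemma foldl_settled t a s m : {in s, forall x, t < r x /\ 0 < p x} -> settled t m ->
  settled t (foldl (step key eps kap w p r a) m s) /\
  same_upto t (foldl (step key eps kap w p r a) m s) m.
Proof.
elim: s m => [|x s IH] m hs sm /=; first by split.
have [tx px] := hs x (mem_head _ _).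
have [h1 h2] := step_settled a tx px sm.
have [|h3 h4] := IH _ _ h1; first by move=> y ys; apply: hs; rewrite inE ys orbT.
by split=> //; apply: same_upto_trans h2.
Qed.

(** Advancing to [t] first changes nothing, because the next event advances at least as far. From
    then on the state is settled and all times recorded are later than [t]. *)
Lemma finish_same_upto t a s m : {in s, forall x, t < r x /\ 0 < p x} ->
  {in pend m, forall x, 0 < p x} ->
  same_upto t (finish w p (foldl (step key eps kap w p r a) m s))
    (advance w p (fun v => v <= t) m).
Proof.
move=> hs hm; set m' := advance _ _ _ m.
have sm' : settled t m'.
  split; first by case: (advance_exit w p (fun v => v <= t) m) => h; [left|right; rewrite ltNge].
  apply: (@advance_ind _ _ w p (fun m' => {in pend m', forall x, 0 < p x})) => //.
  move=> m1 h1 _ h2; have [u [_ _ ->]] := start_next_ex w p h1.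
  by move=> x /mem_rem; exact: h2.
have -> : finish w p (foldl (step key eps kap w p r a) m s) =
    finish w p (foldl (step key eps kap w p r a) m' s).
  case: s hs => [|x s] hs /=; first by rewrite /finish /m' advance_comp.
  have [tx _] := hs x (mem_head _ _).
  by rewrite /step /m' advance_comp // => v vt; apply: le_lt_trans tx.
have [h1 h2] := foldl_settled a hs sm'.
have [_ h3] := advance_settled xpredT h1.
exact: same_upto_trans h3 h2.
Qed.

End Causality.

(** * Rounding down to a power of four *)

Section PowerOfFour.
Variable R : realType.
Implicit Types x y : R.

(** The default 0 is returned only for [x <= 0], where no exponent qualifies. *)
Definition log4 x : int := xget 0%R [set n : int | (4 : R) ^ n <= x < 4 * 4 ^ n]%classic.
Definition pow4_below x : R := 4 ^ (log4 x).

(** With [4 ^- N] below [x], the least natural [k] such that [x < 4 ^+ k * 4 ^- N] is positive, and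
    its predecessor yields the exponent. *)
Lemma log4P x : 0 < x -> 4 ^ (log4 x) <= x < 4 * 4 ^ (log4 x).
Proof.
move=> x0; rewrite /log4; case: xgetP => [n _ //|/(_ _) nex]; exfalso.
have bound y : 0 <= y -> y < 4 ^+ (Num.bound y).
  move=> y0; apply: lt_trans (archi_boundP y0) _.
  by rewrite -natrX ltr_nat ltn_expl.
pose N := Num.bound x^-1.
have lo : 4 ^- N < x.
  have h : x^-1 < 4 ^+ N by apply: bound; rewrite invr_ge0 ltW.
  by rewrite -[x]invrK ltf_pV2 // ?posrE ?invr_gt0 ?exprn_gt0.
have exk : exists k, x < 4 ^+ k * 4 ^- N.
  exists (Num.bound x + N)%N; rewrite exprD mulfK ?expf_neq0 ?pnatr_eq0 //.
  exact: bound (ltW x0).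
have [k hk mk] := ex_minnP exk.
case: k hk mk => [|k] hk mk.
  by move: hk; rewrite expr0 mul1r ltNge ltW.
have hk' : 4 ^+ k * 4 ^- N <= x.
  by rewrite leNgt; apply/negP => /mk; rewrite ltnn.
have e : (4 : R) ^ (k%:Z - N%:Z) = 4 ^+ k * 4 ^- N by rewrite expfzDr ?pnatr_eq0 // -exprnN.
by apply: (nex (k%:Z - N%:Z)) => /=; rewrite e hk' /= mulrA -exprS.
Qed.

Lemma pow4_below_gt0 x : 0 < x -> 0 < pow4_below x.
Proof. by move=> _; rewrite exprz_gt0. Qed.

Lemma pow4_below_le x : 0 < x -> pow4_below x <= x.
Proof. by move=> /log4P /andP[]. Qed.

Lemma pow4_below_gt x : 0 < x -> x < 4 * pow4_below x.
Proof. by move=> /log4P /andP[]. Qed.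

Lemma pow4_below_gap x y : 0 < x -> 0 < y -> pow4_below x < pow4_below y ->
  4 * pow4_below x <= pow4_below y.
Proof.
move=> _ _; rewrite /pow4_below ltr_eXz2l ?ltr1n // => h.
rewrite -{1}[4]expr1z -expfzDr ?pnatr_eq0 // ler_eXz2l ?ltr1n //; lia.
Qed.

End PowerOfFour.

(** * Packing disjoint intervals *)

Section Packing.
Variables (R : realFieldType) (I : eqType) (s p : I -> R).

Lemma max_start (J : seq I) : J != [::] ->
  exists2 j, j \in J & {in J, forall k, s k <= s j}.
Proof.
elim: J => // j [|i J] IH _.
  by exists j; rewrite ?mem_head // => k; rewrite mem_seq1 => /eqP ->.
have [//|k kJ hk] := IH.
case: (leP (s k) (s j)) => h.
  exists j; rewrite ?mem_head // => l; rewrite inE => /predU1P[-> //|/hk h'].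
  exact: le_trans h.
exists k; first by rewrite inE kJ orbT.
by move=> l; rewrite inE => /predU1P[->|/hk //]; exact: ltW.
Qed.

(** Remove the interval that starts last, at [s j]: by disjointness all others end by then, so the
    induction continues on [[A, s j]]. *)
Lemma disjoint_intervals_sum (J : seq I) (A B : R) : A <= B -> uniq J ->
  {in J, forall j, [/\ 0 < p j, A <= s j & s j + p j <= B]} ->
  {in J &, forall j k t, s j <= t < s j + p j -> s k <= t < s k + p k -> j = k} ->
  \sum_(j <- J) p j <= B - A.
Proof.
move: {2}(size J) (leqnn (size J)) => n.
elim: n J B => [|n IH] J B hn AB uJ hJ dJ.
  by case: J hn {uJ hJ dJ} => // _; rewrite big_nil subr_ge0.
case: (eqVneq J [::]) => [->|J0]; first by rewrite big_nil subr_ge0.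
have [j jJ mj] := max_start J0.
have [pj Aj jB] := hJ _ jJ.
rewrite (big_rem j) //=.
have : \sum_(k <- rem j J) p k <= s j - A.
  apply: IH => //.
  - by rewrite size_rem //; case: (size J) hn.
  - exact: rem_uniq.
  - move=> k; rewrite mem_rem_uniq // inE => /andP[kj kJ].
    have [pk Ak _] := hJ _ kJ; split=> //; rewrite leNgt; apply/negP => h.
    have := dJ _ _ jJ kJ (s j); rewrite lexx ltrDl pj mj // h => /(_ isT isT) e.
    by rewrite e eqxx in kj.
  - by move=> k l /mem_rem kJ /mem_rem lJ; exact: dJ.
lra.
Qed.

End Packing.

(** * Dispatching *)

Section Jobs.
Variables (R : realType) (m : nat).

(** A job carries all its parameters, so that a list of jobs is exactly the information released;
    the finite function makes jobs an [eqType]. *)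
Definition job : Type := nat * R * R * {ffun 'I_m -> R}.
Definition name (x : job) : nat := x.1.1.1.
Definition rel (x : job) : R := x.1.1.2.
Definition wt (x : job) : R := x.1.2.
Definition size_on (i : 'I_m) (x : job) : R := x.2 i.

Definition job_of (I : instance R m) (j : nat) : job :=
  (j, release I j, weight I j, [ffun i => proc I i j]).

(** Ties are broken by name, which makes the arrival order independent of how the set of jobs is
    listed. *)
Definition earlier (x y : job) : bool :=
  (rel x < rel y) || (rel x == rel y) && (name x <= name y)%N.

Definition arrivals (I : instance R m) : seq job :=
  sort earlier [seq job_of I j | j <- jobs I].

Lemma earlier_total : total earlier.
Proof.
move=> x y; rewrite /earlier [rel y == _]eq_sym.
by case: ltgtP => //= _; exact: leq_total.
Qed.

Lemma earlier_trans : transitive earlier.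
Proof.
move=> y x z; rewrite /earlier => /orP[h1|/andP[/eqP -> h1]] /orP[h2|/andP[/eqP h3 h2]].
- by rewrite (lt_trans h1 h2).
- by rewrite -h3 h1.
- by rewrite h2.
- by rewrite h3 eqxx (leq_trans h1 h2) orbT.
Qed.

Lemma job_of_inj I : injective (job_of I).
Proof. by move=> j k []. Qed.

Lemma arrivals_uniq I : uniq (arrivals I).
Proof. by rewrite sort_uniq map_inj_uniq ?fset_uniq //; exact: job_of_inj. Qed.

Lemma arrivals_perm I : perm_eq (arrivals I) [seq job_of I j | j <- jobs I].
Proof. by rewrite perm_sort. Qed.

Lemma mem_arrivals I x : (x \in arrivals I) = (name x \in jobs I) && (x == job_of I (name x)).
Proof.
rewrite mem_sort; apply/mapP/andP => [[j jI ->]|[h /eqP e]]; first by rewrite eqxx.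
by exists (name x).
Qed.

Lemma job_of_arrivals I j : (job_of I j \in arrivals I) = (j \in jobs I).
Proof. by rewrite mem_arrivals eqxx andbT. Qed.

Lemma arrivals_sorted I : sorted earlier (arrivals I).
Proof. exact: sort_sorted earlier_total _. Qed.

Lemma arrivals_pairwise I : pairwise (fun x y => rel x <= rel y) (arrivals I).
Proof.
have := arrivals_sorted I; rewrite (sorted_pairwise earlier_trans).
apply: sub_pairwise => x y /orP[/ltW //|/andP[/eqP -> _]]; exact: lexx.
Qed.

Lemma arrivals_wt I : {in arrivals I, forall x, 0 < wt x}.
Proof. by move=> x; rewrite mem_arrivals => /andP[h /eqP ->]; exact: weight_gt0. Qed.

Lemma arrivals_size I i : {in arrivals I, forall x, 0 < size_on i x}.
Proof.
by move=> x; rewrite mem_arrivals => /andP[h /eqP ->]; rewrite /size_on ffunE; exact: proc_gt0.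
Qed.

Definition upto (t : R) I := [seq x <- arrivals I | rel x <= t].
Definition after (t : R) I := [seq x <- arrivals I | t < rel x].

Lemma arrivals_split t I : arrivals I = upto t I ++ after t I.
Proof.
rewrite /upto /after; have := arrivals_pairwise I; elim: (arrivals I) => //= x s IH /andP[hx hs].
case: leP => h /=; first by rewrite {1}IH.
have e : [seq y <- s | rel y <= t] = [::].
  apply/eqP; rewrite -[_ == _]negbK -has_filter -all_predC; apply/allP => y ys /=.
  by rewrite -ltNge (lt_le_trans h) // (allP hx).
by rewrite e /=; congr (_ :: _); apply/esym/all_filterP/allP => y ys; rewrite (lt_le_trans h) // (allP hx).
Qed.

Lemma mem_upto t I x : x \in upto t I = released I t (name x) && (x == job_of I (name x)).
Proof.
rewrite mem_filter mem_arrivals /released andbCA -andbA; congr (_ && _).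
by case: eqP => [->|_]; rewrite ?andbF //= andbT.
Qed.

(** Both lists have the same members and are sorted by an order that is antisymmetric on them, as a
    name determines its job. *)
Lemma upto_agree t I1 I2 : agree_upto t I1 I2 -> upto t I1 = upto t I2.
Proof.
move=> h; apply: (@sorted_eq_in _ earlier).
- by move=> x y z _ _ _; exact: earlier_trans.
- move=> x y; rewrite !mem_upto => /andP[_ /eqP ex] /andP[_ /eqP ey].
  rewrite /earlier [rel y == _]eq_sym => /andP[].
  case: ltgtP => //= _ h1 h2; have e : name x = name y by apply/eqP; rewrite eqn_leq h1.
  by rewrite ex ey e.
- exact/sorted_filter/arrivals_sorted/earlier_trans.
- exact/sorted_filter/arrivals_sorted/earlier_trans.
apply: uniq_perm; rewrite ?filter_uniq ?arrivals_uniq // => x; rewrite !mem_upto.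
have [h1 h2] := h (name x); rewrite -h1.
case: (boolP (released I1 t (name x))) => //= hx; have [e1 e2 e3] := h2 hx.
congr (_ == _); rewrite /job_of e1 e2; congr (_, _).
by apply/ffunP => i; rewrite !ffunE e3.
Qed.

End Jobs.

Section Algorithm.
Variables (R : realType) (n : nat) (eps : R).
Notation job := (job R n.+1).
Notation mstate := (mstate R job).
Implicit Types (x : job) (G : 'I_n.+1 -> mstate) (i : 'I_n.+1).

(** The value of [kap] lets half of the arrival costs absorb the unspent rejection credit; that of
    [gam] makes the sizes in the bids outweigh the weighted sizes lost in the analysis. *)
Definition kap : R := 48 / eps.
Definition gam : R := 16 / eps.

Definition bid G x i : R :=
  delay_cost (@wt R n.+1) (size_on i)
    (advance (@wt R n.+1) (size_on i) (fun t => t < rel x) (G i)) x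
  + gam * (wt x * size_on i x).

Definition choice G x : 'I_n.+1 := [arg min_(i < ord0) bid G x i]%O.

Definition mstep i (a : pred job) m x :=
  step (@pow4_below R) eps kap (@wt R n.+1) (size_on i) (@rel R n.+1) a m x.

Definition gstep G x : 'I_n.+1 -> mstate :=
  fun i => mstep i (fun=> choice G x == i) (G i) x.

(* Release times may be negative, so machines are initially available at the
   first release time. *)
Definition origin (s : seq job) : R := head 0 [seq rel x | x <- s].
Definition grun f0 (s : seq job) := foldl gstep (fun=> init job f0) s.

Definition dispatch (s : seq job) x : 'I_n.+1 :=
  choice (grun (origin s) (take (index x s) s)) x.

Definition gfinal (s : seq job) i : mstate :=
  finish (@wt R n.+1) (size_on i) (grun (origin s) s i).

Definition schedule_of (I : instance R n.+1) : schedule R n.+1 :=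
  let s := arrivals I in
  Schedule
    (fun j => omap (pair (dispatch s (job_of I j)))
       (stime (gfinal s (dispatch s (job_of I j))) (job_of I j)))
    (fun j => rtime (gfinal s (dispatch s (job_of I j))) (job_of I j)).

Lemma bid_choice G x i : bid G x (choice G x) <= bid G x i.
Proof. by rewrite /choice; case: arg_minP => // k _; apply. Qed.

Definition assigned (s : seq job) i : pred job := fun x => dispatch s x == i.

(** Once the dispatching decisions are fixed, the machines evolve independently: each performs the
    run for its own predicate [assigned s i], to which the analysis of one machine applies. *)
Lemma grun_pre s i k : uniq s -> (k <= size s)%N ->
  grun (origin s) (take k s) i =
  pre (@pow4_below R) eps kap (@wt R n.+1) (size_on i) (@rel R n.+1)
    (assigned s i) s (origin s) k.
Proof.
move=> us; elim: k => [_|k IH hk]; first by rewrite /pre take0.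
have [x0 _] : exists x, x \in s by case: (s) hk => // y ? _; exists y; rewrite mem_head.
have ix : index (nth x0 s k) s = k by apply: index_uniq.
rewrite /pre (take_nth x0) // /grun !foldl_rcons -/(grun _ _) -/(pre _ _ _ _ _ _ _ _ _ _).
by rewrite /gstep IH ?(ltnW hk) // /mstep /step /assigned /dispatch ix.
Qed.

Lemma gfinal_final s i : uniq s -> gfinal s i =
  final (@pow4_below R) eps kap (@wt R n.+1) (size_on i) (@rel R n.+1)
    (assigned s i) s (origin s).
Proof. by move=> us; rewrite /gfinal /final -grun_pre // take_size. Qed.

Lemma origin_le I : {in arrivals I, forall x, origin (arrivals I) <= rel x}.
Proof.
move=> x; rewrite /origin; have := arrivals_pairwise I.
case: (arrivals I) => //= y s /andP[/allP h _]; rewrite inE => /predU1P[->|/h] //.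
Qed.

Hypothesis eps0 : 0 < eps.
Hypothesis eps1 : eps < 1.

Lemma kap_gt0 : 0 < kap.
Proof. by rewrite /kap divr_gt0. Qed.

Lemma origin_upto I t x : x \in upto t I -> origin (arrivals I) = origin (upto t I).
Proof. by rewrite (arrivals_split t I) /origin; case: (upto t I). Qed.

Lemma dispatch_upto I t x : x \in upto t I ->
  dispatch (arrivals I) x = choice (grun (origin (upto t I)) (take (index x (upto t I)) (upto t I))) x.
Proof.
move=> xu; rewrite /dispatch (origin_upto xu).
by rewrite (arrivals_split t I) index_cat xu takel_cat ?index_size.
Qed.

(** The jobs released after [t] form the tail of the arrival list and cannot alter decisions up to
    [t]; the state before them depends on [upto t I] only. *)
Lemma gfinal_upto I t x i : x \in upto t I ->
  same_upto t (gfinal (arrivals I) i)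
    (advance (@wt R n.+1) (size_on i) (fun v => v <= t) (grun (origin (upto t I)) (upto t I) i)).
Proof.
move=> xu; set A := upto t I.
have uA := arrivals_uniq I.
have eo : origin (arrivals I) = origin A by exact: origin_upto xu.
have eA : A = take (size A) (arrivals I) by rewrite (arrivals_split t I) take_size_cat.
have sA : (size A <= size (arrivals I))%N by rewrite (arrivals_split t I) size_cat leq_addr.
rewrite gfinal_final // /final /pre take_size eo.
set f := step _ _ _ _ _ _ (assigned _ _).
have -> : foldl f (init job (origin A)) (arrivals I) =
    foldl f (foldl f (init job (origin A)) A) (after t I).
  by rewrite -foldl_cat -arrivals_split.
have -> : foldl f (init job (origin A)) A = grun (origin A) A i.
  by rewrite -eo {2}eA grun_pre // /pre -eA.
apply: finish_same_upto.
  move=> y; rewrite mem_filter => /andP[ty yI]; split=> //; exact: arrivals_size yI.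
have := pre_inv (@pow4_below R) kap (assigned (arrivals I) i) eps0 uA (arrivals_pairwise I)
  (@arrivals_size _ _ I i) (@arrivals_wt _ _ I) (@origin_le I) sA.
rewrite -grun_pre // -eA eo => -[J _].
have [|_ _ _ sP] := inv_uniq _ J; first exact: acc_upto_uniq.
by move=> y /sP /acc_upto_sub; exact: arrivals_size.
Qed.

Lemma schedule_of_nonanticipative : nonanticipative schedule_of.
Proof.
move=> t I1 I2 h j rj.
have eA := upto_agree h.
have [r12 h12] := h j; have [e1 e2 e3] := h12 rj.
have ej : job_of I1 j = job_of I2 j.
  rewrite /job_of e1 e2; congr (_, _); by apply/ffunP => i; rewrite !ffunE e3.
have j1 : job_of I1 j \in upto t I1 by rewrite mem_upto eqxx andbT.
have j2 : job_of I1 j \in upto t I2 by rewrite -eA.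
have ed : dispatch (arrivals I1) (job_of I1 j) = dispatch (arrivals I2) (job_of I1 j).
  by rewrite (dispatch_upto j1) (dispatch_upto j2) eA.
rewrite /start_upto /reject_upto /= -ej -ed; set i := dispatch _ _.
have [s1 r1] := gfinal_upto i j1 (job_of I1 j).
have [s2 r2] := gfinal_upto i j2 (job_of I1 j).
rewrite -eA -s1 -r1 in s2 r2; rewrite /cut in s2 r2.
split; last exact/esym.
by case: (stime _ _) s2 => [v1|]; case: (stime _ _) => [v2|] //=;
  do ?[case: ifP => // _]; move=> // [->].
Qed.

End Algorithm.

(** * Comparison with the adversary *)

Section Performance.
Variables (R : realType) (n : nat) (eps : R) (I : instance R n.+1).
Hypothesis eps0 : 0 < eps.
Hypothesis eps1 : eps < 1.
Notation job := (job R n.+1).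
Implicit Types (x y k : job) (i : 'I_n.+1).

Local Notation w := (@wt R n.+1).
Local Notation r := (@rel R n.+1).
Local Notation key := (@pow4_below R).
Local Notation kp := (kap eps).
Local Notation jl := (arrivals I).
Local Notation f0 := (origin jl).
Local Notation asg i := (assigned eps jl i).
Local Notation d := (dispatch eps jl).

Local Notation fin i := (final key eps kp w (size_on i) r (asg i) jl f0).
Local Notation cost_on i := (arrival_cost key eps kp w (size_on i) r (asg i) jl f0).
Local Notation bou i := (bounced key eps kp w (size_on i) r (asg i) jl f0).
Local Notation acc i := (accepted key eps kp w (size_on i) r (asg i) jl f0).
Local Notation na i := (prior_starts key eps kp w (size_on i) r (asg i) jl f0).
Local Notation qa i := (residual key eps kp w (size_on i) r (asg i) jl f0).
Local Notation dd i := (due (size_on i) r (log (fin i)) (na i) (qa i)).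

Let Hu := arrivals_uniq I.
Let Hs := arrivals_pairwise I.
Let Hw := @arrivals_wt _ _ I.
Let Hp i := @arrivals_size _ _ I i.
Let Hf := @origin_le _ _ I.
Let Hk := kap_gt0 eps0.

Lemma sum_jobs (P : pred nat) (F : nat -> R) :
  \sum_(j <- jobs I | P j) F j = \sum_(x <- jl | P (name x)) F (name x).
Proof. by rewrite (perm_big _ (arrivals_perm I)) /= big_map. Qed.

Lemma sum_machines (P : pred job) (F : job -> R) (o : job -> 'I_n.+1) :
  \sum_(x <- jl | P x) F x = \sum_i \sum_(x <- jl | P x && (o x == i)) F x.
Proof. by rewrite (partition_big o predT). Qed.

Lemma job_ofK x : x \in jl -> job_of I (name x) = x.
Proof. by rewrite mem_arrivals => /andP[_ /eqP]. Qed.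

Lemma size_onE x i : x \in jl -> size_on i x = proc I i (name x).
Proof. by move=> xj; rewrite -{1}(job_ofK xj) /size_on /= ffunE. Qed.

Lemma startE x : x \in jl -> start (schedule_of eps I) (name x) =
  omap (pair (d x)) (stime (fin (d x)) x).
Proof. by move=> xj; rewrite /= job_ofK // gfinal_final. Qed.

Lemma rejectE x : x \in jl -> reject (schedule_of eps I) (name x) = rtime (fin (d x)) x.
Proof. by move=> xj; rewrite /= job_ofK // gfinal_final. Qed.

Lemma accepted_or_bounced x : acc (d x) x || bou (d x) x.
Proof. by rewrite /accepted /bounced /assigned eqxx /= orbN. Qed.

Lemma log_mem x : x \in jl -> (x \in log (fin (d x))) = acc (d x) x.
Proof. by move=> xj; rewrite (mem_log _ _ _ eps0 Hu Hs (Hp (d x)) Hw Hf) xj andbT. Qed.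

Lemma schedule_of_feasible : feasible I (schedule_of eps I).
Proof.
split.
  move=> j jI; have xj : job_of I j \in jl by rewrite job_of_arrivals.
  set x := job_of I j in xj; have ej : j = name x by [].
  have rx : r x = release I j by [].
  have px : size_on (d x) x = proc I (d x) j by rewrite /size_on /= ffunE.
  rewrite /valid_job ej startE // rejectE //.
  have [a|b] := orP (accepted_or_bounced x).
    have xL : x \in log (fin (d x)) by rewrite log_mem.
    have [h1 h2 _] := begins_due eps0 Hu Hs (Hp (d x)) Hw Hf xL.
    rewrite h1 /=; case E : (rtime _ x) => [v|]; last exact: h2.
    have := final_aborted eps0 Hu Hs (Hp (d x)) Hw Hf xL E.
    by rewrite -ej -px => /andP[-> ->]; rewrite h2.
  have [-> ->] /= := final_bounced eps0 Hu Hs (Hp (d x)) Hw Hf xj b.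
  exact: lexx.
move=> i t j k jI kI.
have xj : job_of I j \in jl by rewrite job_of_arrivals.
have yj : job_of I k \in jl by rewrite job_of_arrivals.
set x := job_of I j in xj; set y := job_of I k in yj.
have main z : z \in jl -> processing I (schedule_of eps I) i (name z) t ->
    z \in log (fin i) /\ begins (fin i) z <= t < ends (size_on i) (fin i) z.
  move=> zj; rewrite /processing startE // rejectE // /ends /begins.
  case E : (stime _ z) => [v|] //= /and3P[/eqP di h1 h2].
  rewrite -di E /=; split.
    apply/negPn/negP => zL.
    by have := final_unstarted eps0 Hu Hs (Hp (d z)) Hw Hf zL; rewrite E.
  have -> : size_on (d z) z = proc I (d z) (name z).
    by rewrite -{1 2}(job_ofK zj) /size_on /= ffunE job_ofK.
  by rewrite h1 /=; case: (rtime _ z) h2.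
move=> /(main x xj) [xL hx] /(main y yj) [yL hy].
have := final_disjoint eps0 Hu Hs (Hp i) Hw Hf xL yL hx hy.
exact: job_of_inj.
Qed.

Lemma rejected_weight_le :
  rejected_weight I (schedule_of eps I) <= 2 * eps * total_weight I.
Proof.
rewrite /rejected_weight /total_weight !sum_jobs (sum_machines _ _ d) [X in _ <= _ * X](sum_machines _ _ d).
rewrite mulr_sumr; apply: ler_sum => i _.
have := rejected_total (asg i) eps0 eps1 Hk (@pow4_below_gt0 R) (@pow4_below_le R)
  (@pow4_below_gt R) Hu Hs (Hp i) Hw Hf.
have e : \sum_(x <- jl | true && (d x == i)) weight I (name x) = \sum_(x <- jl | asg i x) w x.
  rewrite big_seq_cond [RHS]big_seq_cond; apply: eq_big => //= x /andP[xj _].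
  by rewrite -{2}(job_ofK xj).
rewrite e; apply: le_trans.
rewrite (perm_big _ (log_perm key kp (asg i) eps0 Hu Hs (Hp i) Hw Hf)) /= big_filter_cond.
rewrite big_mkcond [X in _ <= X + _]big_mkcond [X in _ <= _ + X]big_mkcond -big_split /=.
rewrite big_seq [leRHS]big_seq; apply: ler_sum => x xj.
have wx := Hw xj; have ew : weight I (name x) = w x by rewrite -{2}(job_ofK xj).
rewrite /rejected rejectE // ew.
case: eqP => [di|_]; last first.
  by rewrite andbF; do 2![case: ifP => _]; rewrite ?addr0 ?add0r ?addr_ge0 // ltW.
rewrite -di; have := accepted_or_bounced x.
case: (acc _ x) => /=; case: (bou _ x) => //= _; case: (isSome _) => /=; lra.
Qed.

Lemma algorithm_cost_le :
  weighted_flow_time I (schedule_of eps I) <=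
  \sum_i \sum_(k <- log (fin i)) w k * (dd i k - r k).
Proof.
rewrite /weighted_flow_time sum_jobs (sum_machines _ _ d); apply: ler_sum => i _.
rewrite (perm_big _ (log_perm key kp (asg i) eps0 Hu Hs (Hp i) Hw Hf)) /= big_filter.
rewrite big_mkcond [leRHS]big_mkcond big_seq [leRHS]big_seq; apply: ler_sum => x xj.
have wx := Hw xj; have ew : weight I (name x) = w x by rewrite -{2}(job_ofK xj).
have er : release I (name x) = r x by rewrite -{2}(job_ofK xj).
have a_ge0 : acc i x -> 0 <= w x * (dd i x - r x).
  move=> ax; have xL : x \in log (fin i).
    by rewrite (mem_log _ _ _ eps0 Hu Hs (Hp i) Hw Hf) xj andbT.
  by rewrite mulr_ge0 ?(ltW wx) // subr_ge0; apply: due_ge xL.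
rewrite /rejected rejectE // ew er.
case: eqP => [di|_]; last by rewrite andbF; case: ifP => // /a_ge0.
rewrite andbT; case: ifP => [nr|_]; last by case: ifP => // /a_ge0.
have ax : acc i x.
  have := accepted_or_bounced x; rewrite di => /orP[//|b]; move: nr; rewrite di.
  by have [_ ->] := final_bounced eps0 Hu Hs (Hp i) Hw Hf xj b.
rewrite ax ler_pM2l // lerD2r /completion startE // di.
have xL : x \in log (fin i).
  by rewrite (mem_log _ _ _ eps0 Hu Hs (Hp i) Hw Hf) xj andbT.
have [h1 h2 h3] := begins_due eps0 Hu Hs (Hp i) Hw Hf xL.
rewrite h1 /=; apply: le_trans h3.
by rewrite lerD2l -{2}(job_ofK xj) /size_on /= ffunE.
Qed.

Lemma bid_cost x i : x \in jl ->
  bid eps (grun eps f0 (take (index x jl) jl)) x i =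
  cost_on i x + gam eps * (w x * size_on i x).
Proof. by move=> xj; rewrite /bid grun_pre // index_size. Qed.

Lemma dispatch_cost x i : x \in jl ->
  cost_on (d x) x + gam eps * (w x * size_on (d x) x) <=
  cost_on i x + gam eps * (w x * size_on i x).
Proof. by move=> xj; rewrite -!bid_cost //; exact: bid_choice. Qed.

Section Adversary.
Variable S : schedule R n.+1.
Hypothesis S_complete : complete I S.

Definition machine_of x : 'I_n.+1 := if start S (name x) is Some (i, _) then i else ord0.
Definition start_of x : R := if start S (name x) is Some (_, s) then s else 0.
Definition end_of x : R := start_of x + size_on (machine_of x) x.

Lemma adversary_start x : x \in jl ->
  [/\ start S (name x) = Some (machine_of x, start_of x), reject S (name x) = None,
      r x <= start_of x &
      completion I S (name x) = end_of x].
Proof.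
move=> xj; have := xj; rewrite mem_arrivals => /andP[nj /eqP ex].
have [[V _] N] := S_complete.
have := V _ nj; have := N _ nj; rewrite /rejected /valid_job /completion /end_of /machine_of /start_of.
case: (reject S (name x)) => //= _; case: (start S (name x)) => // -[i s] h.
split=> //; first by rewrite ex.
by rewrite ex /size_on /= ffunE.
Qed.

Lemma adversary_cost :
  weighted_flow_time I S = \sum_(x <- jl) w x * (end_of x - r x).
Proof.
rewrite /weighted_flow_time sum_jobs big_mkcond big_seq [RHS]big_seq.
apply: eq_bigr => x xj; have [_ rj _ ->] := adversary_start xj.
have ew : weight I (name x) = w x by rewrite -{2}(job_ofK xj).
have er : release I (name x) = r x by rewrite -{2}(job_ofK xj).
by rewrite /rejected rj /= ew er.
Qed.

Lemma adversary_cost_ge0 : 0 <= weighted_flow_time I S.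
Proof.
rewrite adversary_cost big_seq sumr_ge0 // => x xj.
have [_ _ rx _] := adversary_start xj; have := Hp (machine_of x) xj => px.
by rewrite mulr_ge0 ?(ltW (Hw xj)) // /end_of; lra.
Qed.

Lemma adversary_disjoint x y t : x \in jl -> y \in jl -> machine_of x = machine_of y ->
  start_of x <= t < end_of x -> start_of y <= t < end_of y -> x = y.
Proof.
move=> xj yj exy hx hy; have [[_ D] _] := S_complete.
have main z : z \in jl -> start_of z <= t < end_of z -> processing I S (machine_of z) (name z) t.
  move=> zj /andP[h1 h2]; have [e1 e2 _ _] := adversary_start zj.
  rewrite /processing e1 e2 eqxx h1 /=; move: h2.
  by rewrite /end_of size_onE.
have jx : name x \in jobs I by move: xj; rewrite mem_arrivals => /andP[].
have jy : name y \in jobs I by move: yj; rewrite mem_arrivals => /andP[].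
have px := main x xj hx; have := main y yj hy; rewrite -exy => py.
by rewrite -(job_ofK xj) -(job_ofK yj) (D _ _ _ _ jx jy px py).
Qed.

(** The adversary runs these jobs on machine [i] one after the other, none before the release of
    [k], since [k] was already waiting when they arrived, and all before [k] is due. *)
Lemma packed_delay i k : k \in log (fin i) ->
  \sum_(x <- jl | (machine_of x == i) &&
      (waits (log (fin i)) (na i) (before jl) x k && (end_of x < dd i k))) size_on i x
  <= dd i k - r k.
Proof.
move=> kL; rewrite -big_filter.
apply: (@disjoint_intervals_sum _ _ start_of).
- exact: due_ge kL.
- exact: filter_uniq.
- move=> x; rewrite mem_filter => /andP[/andP[/eqP mx /andP[wx ex]] xj].
  have [_ _ rx _] := adversary_start xj; split; first exact: Hp.
    by apply: le_trans rx; apply: waits_release wx.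
  by have := ltW ex; rewrite /end_of mx.
move=> x y; rewrite !mem_filter => /andP[/andP[/eqP mx _] xj] /andP[/andP[/eqP my _] yj] t hx hy.
by apply: (adversary_disjoint (t := t)); rewrite // /end_of ?mx ?my.
Qed.

(** [arrival_cost_le] is applied with [e] the end of [x] in the schedule of the adversary. After
    exchanging the sums, each [k] pays [w k] times the sizes charged to it, which [packed_delay]
    bounds by its own delay. *)
Lemma adversary_arrival_cost :
  \sum_(x <- jl) cost_on (machine_of x) x <=
  \sum_(x <- jl) w x * (end_of x - r x) +
  \sum_i \sum_(k <- log (fin i)) w k * (dd i k - r k).
Proof.
pose F x i := \sum_(k <- log (fin i) |
   waits (log (fin i)) (na i) (before jl) x k && (end_of x < dd i k)) w k * size_on i x.
apply: (@le_trans _ _ (\sum_(x <- jl) (w x * (end_of x - r x) + F x (machine_of x)))).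
  rewrite big_seq [leRHS]big_seq; apply: ler_sum => x xj.
  have [_ _ rx _] := adversary_start xj.
  apply: arrival_cost_le => //; apply: le_trans rx _.
  by rewrite /end_of lerDl ltW // Hp.
rewrite big_split /= lerD2l (sum_machines _ _ machine_of); apply: ler_sum => i _.
have -> : \sum_(x <- jl | true && (machine_of x == i)) F x (machine_of x) =
    \sum_(x <- jl | machine_of x == i) F x i.
  by apply: eq_big => //= x /eqP ->.
rewrite /F (exchange_big_dep xpredT) //=.
rewrite big_seq [leRHS]big_seq; apply: ler_sum => k kL.
have wk : 0 < w k by apply: Hw; apply: log_sub kL.
by rewrite -mulr_sumr ler_pM2l //; exact: packed_delay.
Qed.

(** Here [Lam] is the total arrival cost, [B] its bounced part, [W] the weighted sizes and [O] the
    cost of the adversary. Adding [h1] and [h3'] cancels [Lam] and [D] and leaves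
    [eps * B + 14 * W <= 17 * O]. By [h1] and [h2], [eps ^+ 2 * D] is at most
    [8 * (eps * B) + 100 * (eps * W)], hence at most [8 * 17 * O = 136 * O]. *)
Lemma algorithm_vs_adversary :
  eps ^+ 2 * weighted_flow_time I (schedule_of eps I) <= 136 * weighted_flow_time I S.
Proof.
pose D := \sum_i \sum_(k <- log (fin i)) w k * (dd i k - r k).
pose Lam := \sum_(x <- jl) cost_on (d x) x.
pose W := \sum_(x <- jl) w x * size_on (d x) x.
pose B := \sum_i \sum_(x <- jl | bou i x) cost_on i x.
pose O := \sum_(x <- jl) w x * (end_of x - r x).
have eLam : Lam = \sum_i \sum_(x <- jl | asg i x) cost_on i x.
  by rewrite /Lam (sum_machines _ _ d); apply: eq_bigr => i _; apply: eq_big => //= x /eqP ->.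
have eW : W = \sum_i \sum_(x <- jl | asg i x) w x * size_on i x.
  by rewrite /W (sum_machines _ _ d); apply: eq_bigr => i _; apply: eq_big => //= x /eqP ->.
have h1 : eps * D <= eps * (Lam - B) + 2 * W.
  rewrite eLam eW /B /D -sumrB !mulr_sumr -big_split /=.
  by apply: ler_sum => i _; exact: due_total.
have h2 : eps * Lam <= 8 * B + 98 * W.
  rewrite eLam eW /B !mulr_sumr -big_split /=.
  apply: ler_sum => i _; apply: arrival_cost_total => //;
    [exact: pow4_below_gt0|exact: pow4_below_le|exact: pow4_below_gt|exact: pow4_below_gap].
have W0 : 0 <= W.
  by rewrite /W big_seq sumr_ge0 // => x xj; rewrite mulr_ge0 // ltW ?Hw ?Hp.
have h3 : Lam + gam eps * W <= (O + D) + gam eps * O.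
  rewrite /Lam /W mulr_sumr -big_split /=.
  apply: (@le_trans _ _ (\sum_(x <- jl) (cost_on (machine_of x) x +
      gam eps * (w x * size_on (machine_of x) x)))).
    by rewrite big_seq [leRHS]big_seq; apply: ler_sum => x; exact: dispatch_cost.
  rewrite big_split /=; apply: lerD; first exact: adversary_arrival_cost.
  rewrite -mulr_sumr ler_pM2l ?divr_gt0 // /O.
  rewrite big_seq [leRHS]big_seq; apply: ler_sum => x xj.
  have [_ _ rx _] := adversary_start xj.
  by rewrite ler_pM2l ?Hw // /end_of; lra.
have O0 : 0 <= O by rewrite /O -adversary_cost adversary_cost_ge0.
have h3' : eps * Lam + 16 * W <= eps * (O + D) + 16 * O.
  have := ler_wpM2l (ltW eps0) h3; rewrite !mulrDr /gam !mulrA.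
  by rewrite (_ : eps * 16 / eps = 16) //; field; exact: lt0r_neq0.
have c := algorithm_cost_le; rewrite -/D in c.
rewrite adversary_cost -/O.
have e2 : 0 <= eps ^+ 2 by rewrite exprn_ge0 // ltW.
apply: (le_trans (ler_wpM2l e2 c)).
have eW1 : eps * W <= W by rewrite ler_piMl // ltW.
have eO1 : eps * O <= O by rewrite ler_piMl // ltW.
have g1 : eps ^+ 2 * D <= eps * (eps * Lam) - eps * (eps * B) + 2 * (eps * W).
  by have := ler_wpM2l (ltW eps0) h1; rewrite expr2; lra.
have g2 : eps * (eps * Lam) <= 8 * (eps * B) + 98 * (eps * W).
  by have := ler_wpM2l (ltW eps0) h2; lra.
have B0 : 0 <= eps * (eps * B).
  rewrite !mulr_ge0 ?(ltW eps0) // /B sumr_ge0 // => i _; rewrite big_seq_cond sumr_ge0 // => x /andP[xj _].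
  rewrite /arrival_cost /delay_cost big_seq sumr_ge0 // => k kP.
  have kj : k \in jl.
    have [Iv _] := arrival_inv key kp (asg i) eps0 Hu Hs (Hp i) Hw Hf xj.
    have [|_ _ _ sP] := inv_uniq _ Iv; first exact: acc_upto_uniq.
    exact: acc_upto_sub (sP _ kP).
  by rewrite le_min; apply/andP; split; apply: mulr_ge0; apply/ltW; [apply: Hw|apply: Hp|apply: Hw|apply: Hp].
lra.
Qed.

End Adversary.

End Performance.

(** All jobs run back to back on machine [ord0], from a time [M] that no release exceeds. Thus the
    infimum in [opt] is over a nonempty set. *)
Lemma complete_exists (R : realType) (n : nat) (I : instance R n.+1) :
  exists S, complete I S.
Proof.
pose M : R := \sum_(j <- jobs I) `|release I j|.
pose st (j : nat) : R := M + pos (proc I ord0) (jobs I) (index j (jobs I)).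
have uJ : uniq (jobs I) by exact: fset_uniq.
have pJ : {in jobs I : seq nat, forall j, 0 < proc I ord0 j} by move=> j; exact: proc_gt0.
exists (Schedule (fun j => Some (ord0, st j)) (fun=> None)).
split=> //; split=> [j jI|i t j k jI kI]; rewrite /valid_job /processing /=.
  apply: (@le_trans _ _ M); last by rewrite lerDl (pos_ge0 uJ pJ).
  apply: le_trans (ler_norm _) _; rewrite /M (bigD1_seq j) //= lerDl.
  by apply: sumr_ge0 => k _; exact: normr_ge0.
have main (x y : nat) : x \in (jobs I : seq nat) -> (index x (jobs I) < index y (jobs I))%N ->
    st x + proc I ord0 x <= st y.
  by move=> xI h; rewrite /st -addrA lerD2l -posS // pos_le.
move=> /and3P[_ j1 j2] /and3P[_ k1 k2].
case: (ltngtP (index j (jobs I)) (index k (jobs I))) => h.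
- by exfalso; have := main _ _ jI h; lra.
- by exfalso; have := main _ _ kI h; lra.
by rewrite -(nth_index 0%N jI) h nth_index.
Qed.

(** * Competitive ratio and rejected weight *)

Section MainTheorem.
Variables (R : realType) (eps : R).
Hypothesis eps0 : 0 < eps.
Hypothesis eps1 : eps < 1.

Program Definition no_machine : online_algorithm R 0 :=
  @OnlineAlgorithm R 0 (fun I => Schedule (fun=> None) (fun j => Some (release I j))) _ _.
Next Obligation. by split=> [j _|[]] //; rewrite /valid_job /=. Qed.
Next Obligation.
move=> t I1 I2 h j rj; have [_ /(_ rj)[e _ _]] := h j.
by rewrite /reject_upto /= e.
Qed.

Definition algorithm (m : nat) : online_algorithm R m :=
  match m with
  | 0 => no_machine
  | n.+1 => @OnlineAlgorithm R n.+1 (@schedule_of R n eps)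
      (fun I => schedule_of_feasible I eps0) (@schedule_of_nonanticipative R n eps eps0)
  end.

(** The comparison holds with ratio [136 / eps ^+ 2] against every complete schedule, hence against
    the infimum; [eps < 1] turns it into the stated ratio. *)
Lemma algorithm_competitive (m : nat) : (0 < m)%N ->
  competitive (136 / eps ^+ 3) (algorithm m).
Proof.
case: m => // n _ I; rewrite /opt [_ (algorithm _) _]/=.
have e3 : 0 < eps ^+ 3 by rewrite exprn_gt0.
rewrite mulrAC ler_pdivlMr // -ler_pdivrMl //.
apply: lb_le_inf; first by have [S hS] := complete_exists I; exists (weighted_flow_time I S), S.
move=> _ [S hS <-]; rewrite ler_pdivrMl // mulrC exprS -mulrA.
have h := algorithm_vs_adversary eps0 eps1 hS.
have h0 := adversary_cost_ge0 hS.
apply: (le_trans (ler_wpM2l (ltW eps0) h)).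
by rewrite ler_piMl ?(ltW eps1) // mulr_ge0.
Qed.

End MainTheorem.

Theorem theorem1 (R : realType) :
  exists c1 c2 : R, 0 < c1 /\ 0 < c2 /\
  forall eps : R, 0 < eps -> eps < 1 ->
  exists A : forall m : nat, online_algorithm R m,
  forall m : nat, (0 < m)%N ->
    competitive (c1 / eps ^+ 3) (A m) /\
    (forall I : instance R m,
       rejected_weight I (A m I) <= c2 * eps * total_weight I).
Proof.
exists 136, 2; split=> //; split=> // eps eps0 eps1.
exists (algorithm eps0) => m m0; split; first exact: algorithm_competitive.
by case: m m0 => // n _ I; exact: rejected_weight_le.
Qed.
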